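(* For each $n\ge0$ (and $\theta\in\{0,1\}$), the discrete system of the MFEM scheme has a unique solution $(\mathbf{u}_h^{n+1},\xi_h^{n+1},\eta_h^{n+1})\in\mathbf{V}_h\times M_h\times W_h$.
   Context: Setting: $\Omega\subset\mathbb{R}^2$ bounded convex polygonal domain, $T>0$; parameters $\lambda,\mu>0$, $\alpha>0$, $c_0>0$, $\mu_f>0$, constants $\rho_f$, $\mathbf{g}$; symmetric $K(x)$ with $K_1|\zeta|^2\le K\zeta\cdot\zeta\le K_2|\zeta|^2$. $\varepsilon(\mathbf{u})=\tfrac12(\nabla\mathbf{u}+\nabla\mathbf{u}^T)$; $\sigma$ is the Hencky–Mises stress $\sigma(\mathbf{u})=\tilde\lambda(\mathrm{dev}\,\varepsilon(\mathbf{u}))\mathrm{tr}(\varepsilon(\mathbf{u}))\mathbf{I}+\tilde\mu(\mathrm{dev}\,\varepsilon(\mathbf{u}))\varepsilon(\mathbf{u})$ with $\mathrm{dev}(\tau)=\mathrm{tr}(\tau^2)-\tfrac12\mathrm{tr}^2\tau$, $\tilde\mu=2\mu\Phi'$, $\tilde\lambda=\kappa-\tfrac12\tilde\mu$ ($0<k_0\le\kappa\le k_1$, $\Phi\in C^2$, $a_1\le\mu\Phi'<\kappa$, $|\rho\Phi''|\le a_2$, $\Phi'+2\rho\Phi''\ge a_3$); $\mathcal{N}(\varepsilon(\mathbf{u}))=\sigma(\mathbf{u})-\lambda^{-1}(\mathrm{div}\,\mathbf{u})\mathbf{I}$, assumed strongly monotone and Lipschitz in $\varepsilon$ (which holds when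 $\lambda>2/C_3$, $C_3$ the monotonicity constant of $\sigma$); $\kappa_1=\frac{\lambda\alpha}{\lambda\alpha^2+c_0}$, $\kappa_2=\frac1{\lambda\alpha^2+c_0}$, $\kappa_3=\frac{\lambda c_0}{\lambda\alpha^2+c_0}$. Data $\mathbf{f}\in L^2(\Omega)^2,\mathbf{f}_1\in L^2(\partial\Omega)^2,\phi\in L^2(\Omega),\phi_1\in L^2(\partial\Omega)$. $\mathbf{RM}$ = rigid motions $\{\mathbf{a}+b(-x_2,x_1)^T\}$. Discretization: $\mathcal{T}_h$ quasi-uniform triangulation; $\mathbf{X}_h$ = continuous piecewise quadratic vector fields; $\mathbf{V}_h=\{\mathbf{v}_h\in\mathbf{X}_h:(\mathbf{v}_h,\mathbf{r})=0\ \forall\mathbf{r}\in\mathbf{RM}\}$; $M_h=W_h$ = continuous piecewise linears. $\Delta t=T/N$, $t_n=n\Delta t$, $d_tw^{n+1}=(w^{n+1}-w^n)/\Delta t$. Given $(\mathbf{u}_h^n,\xi_h^n,\eta_h^n)$ (and $\eta_h^{n-1}$ when $\theta=0$), the MFEM step seeks $(\mathbf{u}_h^{n+1},\xi_h^{n+1},\eta_h^{n+1})$ with $(\mathcal{N}(\varepsilon(\mathbf{u}_h^{n+1})),\varepsilon(\mathbf{v}_h))-(\xi_h^{n+1},\mathrm{div}\,\mathbf{v}_h)=(\mathbf{f}(t_{n+1}),\mathbf{v}_h)+\langle\mathbf{f}_1(t_{n+1}),\mathbf{v}_h\rangle$ $\forall\mathbf{v}_h\in\mathbf{V}_h$; $\kappa_3(\xi_h^{n+1},\varphi_h)+(\mathrm{div}\,\mathbf{u}_h^{n+1},\varphi_h)=\kappa_1(\eta_h^{n+\theta},\varphi_h)$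 $\forall\varphi_h\in M_h$; $(d_t\eta_h^{n+1},\psi_h)+\frac1{\mu_f}(K(\nabla(\kappa_1\xi_h^{n+1}+\kappa_2\eta_h^{n+1})-\rho_f\mathbf{g}),\nabla\psi_h)=(\phi,\psi_h)+\langle\phi_1,\psi_h\rangle$ $\forall\psi_h\in M_h$. *)

(* Defs.v *)
From HB Require Import structures.
From mathcomp Require Import all_boot all_order all_algebra.
From mathcomp Require Import all_classical all_reals all_analysis.
Set Implicit Arguments. Unset Strict Implicit. Unset Printing Implicit Defensive.
Import Order.TTheory GRing.Theory Num.Theory.
Import numFieldNormedType.Exports.
Local Open Scope classical_set_scope.
Local Open Scope ring_scope.

Section MFEM.
Context {R : realType}.

Definition pt := (R * R)%type.
Definition tri := (pt * pt * pt)%type.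
Definition tri0 : tri := ((0,0),(0,0),(0,0)).
Definition tv1 (t : tri) : pt := t.1.1.
Definition tv2 (t : tri) : pt := t.1.2.
Definition tv3 (t : tri) : pt := t.2.
Definition verts (t : tri) : seq pt := [:: tv1 t; tv2 t; tv3 t].

Definition comb3 (a b c : pt) (l1 l2 l3 : R) : pt :=
  (l1 * a.1 + l2 * b.1 + l3 * c.1, l1 * a.2 + l2 * b.2 + l3 * c.2).

Definition tri_set (t : tri) : set pt :=
  [set x | exists l1 l2 l3 : R, [/\ 0 <= l1, 0 <= l2, 0 <= l3, l1 + l2 + l3 = 1
     & x = comb3 (tv1 t) (tv2 t) (tv3 t) l1 l2 l3]].
Definition otri_set (t : tri) : set pt :=
  [set x | exists l1 l2 l3 : R, [/\ 0 < l1, 0 < l2, 0 < l3, l1 + l2 + l3 = 1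
     & x = comb3 (tv1 t) (tv2 t) (tv3 t) l1 l2 l3]].

Definition nondegenerate (t : tri) : Prop :=
  ((tv2 t).1 - (tv1 t).1) * ((tv3 t).2 - (tv1 t).2)
  - ((tv3 t).1 - (tv1 t).1) * ((tv2 t).2 - (tv1 t).2) != 0.

Definition lin2 (s : R) (a b : pt) : pt :=
  ((1 - s) * a.1 + s * b.1, (1 - s) * a.2 + s * b.2).
Definition seg (a b : pt) : set pt :=
  [set x | exists s : R, [/\ 0 <= s, s <= 1 & x = lin2 s a b]].

Definition conforming (t t' : tri) : Prop :=
  let I := tri_set t `&` tri_set t' in
  [\/ I = set0,
      exists v, [/\ v \in verts t, v \in verts t' & I = [set v]]
    | exists a b, [/\ a != b, (a \in verts t) && (b \in verts t),
                     (a \in verts t') && (b \in verts t') & I = seg a b]].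

Definition convex_set (O : set pt) : Prop :=
  forall x y s, O x -> O y -> 0 <= s -> s <= 1 -> O (lin2 s x y).

Definition triangulation (Omega : set pt) (Th : seq tri) : Prop :=
  [/\ open Omega /\ Omega !=set0, convex_set Omega,
      closure Omega = [set x | exists2 t, t \in Th & tri_set t x],
      (forall t, t \in Th -> nondegenerate t) &
      (forall i j, (i < size Th)%N -> (j < size Th)%N -> i != j ->
         conforming (nth tri0 Th i) (nth tri0 Th j))].

Definition P1_on (S : set pt) (f : pt -> R) : Prop :=
  exists c0 c1 c2 : R, forall x, S x -> f x = c0 + c1 * x.1 + c2 * x.2.
Definition P2_on (S : set pt) (f : pt -> R) : Prop :=
  exists c0 c1 c2 c3 c4 c5 : R, forall x, S x ->
    f x = c0 + c1 * x.1 + c2 * x.2 + c3 * x.1 ^+ 2 + c4 * (x.1 * x.2)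
          + c5 * x.2 ^+ 2.

(* continuous piecewise P1 / P2 scalar functions on closure Omega;
   functions are normalised to vanish outside closure Omega *)
Definition Pk_fe (k2 : bool) (Omega : set pt) (Th : seq tri) (f : pt -> R) :=
  [/\ forall t, t \in Th -> (if k2 then P2_on else P1_on) (tri_set t) f,
      {within closure Omega, continuous f} &
      forall x, ~ closure Omega x -> f x = 0].

Definition vfield := ((pt -> R) * (pt -> R))%type.

Definition Xh Omega Th (v : vfield) : Prop :=
  Pk_fe true Omega Th v.1 /\ Pk_fe true Omega Th v.2.
Definition Mh Omega Th (p : pt -> R) : Prop := Pk_fe false Omega Th p.
Definition Wh := Mh.

Definition leb2 := ((@lebesgue_measure R) \x (@lebesgue_measure R))%E.
Definition ip (Omega : set pt) (f g : pt -> R) : R :=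
  Rintegral leb2 Omega (fun x => f x * g x).
Definition ipv (Omega : set pt) (f g : vfield) : R :=
  Rintegral leb2 Omega (fun x => f.1 x * g.1 x + f.2 x * g.2 x).

Definition I01 : set R := `[0, 1]%classic.

Definition edges (t : tri) : seq (pt * pt) :=
  [:: (tv1 t, tv2 t); (tv2 t, tv3 t); (tv3 t, tv1 t)].
Definition same_edge (e e' : pt * pt) : Prop :=
  (e.1 = e'.1 /\ e.2 = e'.2) \/ (e.1 = e'.2 /\ e.2 = e'.1).
Definition bedge (Th : seq tri) (i : nat) (e : pt * pt) : Prop :=
  forall j, (j < size Th)%N -> j != i ->
    forall e', e' \in edges (nth tri0 Th j) -> ~ same_edge e e'.
Definition elen (e : pt * pt) : R :=
  Num.sqrt ((e.2.1 - e.1.1) ^+ 2 + (e.2.2 - e.1.2) ^+ 2).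
Definition eint (e : pt * pt) (h : pt -> R) : R :=
  elen e * Rintegral (@lebesgue_measure R) I01
                     (fun s => h (lin2 s e.1 e.2)).
Definition bip (Th : seq tri) (f g : pt -> R) : R :=
  \sum_(i < size Th)
    \sum_(e <- edges (nth tri0 Th i) | `[< bedge Th i e >])
       eint e (fun x => f x * g x).
Definition bipv (Th : seq tri) (f g : vfield) : R :=
  bip Th f.1 g.1 + bip Th f.2 g.2.

Definition L2dom (Omega : set pt) (f : pt -> R) : Prop :=
  measurable_fun Omega f /\ leb2.-integrable Omega (fun x => (f x ^+ 2)%:E).
Definition L2bnd (Th : seq tri) (f : pt -> R) : Prop :=
  forall i e, (i < size Th)%N -> e \in edges (nth tri0 Th i) -> bedge Th i e ->
    measurable_fun I01 (fun s => f (lin2 s e.1 e.2)) /\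
    (@lebesgue_measure R).-integrable I01
        (fun s => (f (lin2 s e.1 e.2) ^+ 2)%:E).

Definition rigid (a1 a2 b : R) : vfield :=
  (fun x => a1 - b * x.2, fun x => a2 + b * x.1).
Definition Vh Omega Th (v : vfield) : Prop :=
  Xh Omega Th v /\ forall a1 a2 b, ipv Omega v (rigid a1 a2 b) = 0.

(* classical partial derivatives, taken inside the open cells (the
   derivative of the broken function is defined a.e.; set to 0 on
   the skeleton, a null set) *)
Definition pd (Th : seq tri) (j : 'I_2) (f : pt -> R) (x : pt) : R :=
  if `[< exists2 t, t \in Th & otri_set t x >] then
    (if j == ord0 then derive1 (fun s => f (s, x.2)) x.1
     else derive1 (fun s => f (x.1, s)) x.2)
  else 0.
Definition vcomp (v : vfield) (i : 'I_2) : pt -> R :=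
  if i == ord0 then v.1 else v.2.
Definition eps Th (u : vfield) (x : pt) : 'M[R]_2 :=
  \matrix_(i < 2, j < 2)
     (2^-1 * (pd Th j (vcomp u i) x + pd Th i (vcomp u j) x)).
Definition divv Th (u : vfield) (x : pt) : R :=
  pd Th ord0 u.1 x + pd Th (lift ord0 ord0) u.2 x.
Definition grad Th (f : pt -> R) (x : pt) : 'cV[R]_2 :=
  \col_(j < 2) pd Th j f x.

Definition ddot (A B : 'M[R]_2) : R := \sum_(i < 2) \sum_(j < 2) A i j * B i j.
Definition vdot (a b : 'cV[R]_2) : R := \sum_(i < 2) a i ord0 * b i ord0.
Definition devm (tau : 'M[R]_2) : R := \tr (tau *m tau) - 2^-1 * (\tr tau) ^+ 2.
Definition mu_t (mu : R) (Phi : R -> R) (rho : R) : R := 2 * mu * derive1 Phi rho.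
Definition lam_t (kappa mu : R) (Phi : R -> R) (rho : R) : R :=
  kappa - 2^-1 * mu_t mu Phi rho.
Definition sigmaHM (kappa mu : R) (Phi : R -> R) (tau : 'M[R]_2) : 'M[R]_2 :=
  (lam_t kappa mu Phi (devm tau) * \tr tau) *: 1%:M
  + mu_t mu Phi (devm tau) *: tau.
(* N(eps) = sigma - lambda^{-1} (div u) I, with div u = tr eps(u) *)
Definition Nop (kappa mu lambda : R) (Phi : R -> R) (tau : 'M[R]_2) : 'M[R]_2 :=
  sigmaHM kappa mu Phi tau - (lambda^-1 * \tr tau) *: 1%:M.

Definition sym_mx (tau : 'M[R]_2) : Prop := tau^T = tau.
Definition strongly_monotone (N : 'M[R]_2 -> 'M[R]_2) : Prop :=
  exists C : R, 0 < C /\ forall t1 t2, sym_mx t1 -> sym_mx t2 ->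
    C * ddot (t1 - t2) (t1 - t2) <= ddot (N t1 - N t2) (t1 - t2).
Definition lipschitz_mx (N : 'M[R]_2 -> 'M[R]_2) : Prop :=
  exists L : R, 0 < L /\ forall t1 t2, sym_mx t1 -> sym_mx t2 ->
    Num.sqrt (ddot (N t1 - N t2) (N t1 - N t2))
      <= L * Num.sqrt (ddot (t1 - t2) (t1 - t2)).

Definition kap1 (lambda alpha c0 : R) := lambda * alpha / (lambda * alpha ^+ 2 + c0).
Definition kap2 (lambda alpha c0 : R) := (lambda * alpha ^+ 2 + c0)^-1.
Definition kap3 (lambda alpha c0 : R) := lambda * c0 / (lambda * alpha ^+ 2 + c0).

Definition mfem_step (Omega : set pt) (Th : seq tri)
  (lambda mu kappa alpha c0 muf rhof : R) (g : 'cV[R]_2) (K : pt -> 'M[R]_2)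
  (Phi : R -> R) (f f1 : R -> vfield) (phi phi1 : pt -> R)
  (dt tn1 : R) (theta : bool) (eta_n : pt -> R)
  (u : vfield) (xi eta : pt -> R) : Prop :=
  let k1 := kap1 lambda alpha c0 in
  let k2 := kap2 lambda alpha c0 in
  let k3 := kap3 lambda alpha c0 in
  let eta_th := if theta then eta else eta_n in
  [/\ forall v, Vh Omega Th v ->
        Rintegral leb2 Omega
          (fun x => ddot (Nop kappa mu lambda Phi (eps Th u x)) (eps Th v x))
        - ip Omega xi (divv Th v)
        = ipv Omega (f tn1) v + bipv Th (f1 tn1) v,
      forall ph, Mh Omega Th ph ->
        k3 * ip Omega xi ph + ip Omega (divv Th u) ph = k1 * ip Omega eta_th ph &
      forall ps, Mh Omega Th ps ->
        ip Omega (fun x => (eta x - eta_n x) / dt) ps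
        + muf^-1 * Rintegral leb2 Omega
            (fun x => vdot (K x *m (grad Th (fun y => k1 * xi y + k2 * eta y) x
                                     - rhof *: g))
                           (grad Th ps x))
        = ip Omega phi ps + bip Th phi1 ps].

End MFEM.

(* Main.v *)
Require Import Defs.
From HB Require Import structures.
From mathcomp Require Import all_boot all_order all_algebra.
From mathcomp Require Import all_classical all_reals all_analysis.
From mathcomp Require Import measurable_realfun.
From mathcomp Require Import ring lra.
Import Order.TTheory GRing.Theory Num.Theory.
Import numFieldNormedType.Exports.
Local Open Scope classical_set_scope.
Local Open Scope ring_scope.

Set Implicit Arguments.
Unset Strict Implicit.
Unset Printing Implicit Defensive.

(* On the finite-dimensional space V_h x M_h x W_h the three equations are tested
   simultaneously with (v, phi, psi), where psi = B (kappa_1 phi + kappa_2 chi)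
   for a suitable weight B > 0 and chi ranges over W_h. For theta = 1 and B = 1
   the couplings cancel exactly; for theta = 0 a small B suffices. The combined
   operator is Lipschitz and strongly monotone for
   (eps(u), eps(u)) + (xi, xi) + (eta, eta), which is definite by a discrete Korn
   argument, so a contraction argument in an orthonormal basis gives a solution.
   The permeability term is used only through its sign, and no inf-sup condition
   is needed because kappa_3 > 0. *)

(** The permeability form has a sign when both of its slots carry the same pressure, which dictates
    the test function of the third equation. Since [k2 > 0] and the two scalar spaces coincide,
    passing from [chi] to [psi] for fixed [phi] is a bijection, so the combined equation is
    equivalent to the three separate ones. Multiplying the third equation by the time step turns its
    first term into [(eta, psi)]; the cross term [B * k1 * (eta, xi)] of that product meets
    [- k1 * (eta, xi)] from the second equation when the coupling is implicit. When it is explicit,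
    [eta_n] is data, nothing cancels, and [B] has to be tuned to [k2] and [k3]. The discrete spaces
    are predicates on functions and come without a basis. Piecewise coefficients bound the length of
    orthonormal families, and one of maximal length is a basis. Only the stress is nonlinear, so the
    Lipschitz estimate is asked only of what remains after a linear form is subtracted. *)

HB.instance Definition _ (R : realType) m n := Complete.on 'M[R]_(m, n).

(** * Zeros of strongly monotone Lipschitz maps on row vectors *)

Definition sqsum (R : realType) (d : nat) (v : 'rV[R]_d) : R :=
  \sum_(i < d) v 0 i ^+ 2.

Lemma sqsum_ge0 (R : realType) (d : nat) (v : 'rV[R]_d) : 0 <= sqsum v.
Proof. by apply: sumr_ge0 => i _; exact: sqr_ge0. Qed.

Lemma norm_sqsum (R : realType) (d : nat) (v : 'rV[R]_d) : `|v| ^+ 2 <= sqsum v.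
Proof.
have -> : `|v| = mx_norm v by [].
have [->|/mx_norm_neq0 [[i j] ->]] := eqVneq (mx_norm v) 0.
  by rewrite expr0n sqsum_ge0.
rewrite /= ord1 real_normK ?num_real// /sqsum (bigD1 j)//= lerDl.
by apply: sumr_ge0 => k _; exact: sqr_ge0.
Qed.

Lemma sqsum_norm (R : realType) (d : nat) (v : 'rV[R]_d) :
  sqsum v <= d%:R * `|v| ^+ 2.
Proof.
have -> : d%:R * `|v| ^+ 2 = \sum_(i < d) `|v| ^+ 2.
  by rewrite sumr_const card_ord mulr_natl.
apply: ler_sum => i _; rewrite -[leLHS]real_normK ?num_real//.
rewrite ler_sqr ?nnegrE//.
have -> : `|v| = mx_norm v by [].
rewrite mx_normrE.
exact: (le_bigmax _ (fun ij : 'I_1 * 'I_d => `|v ij.1 ij.2|) (0, i)).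
Qed.

(* A large iterate contracts the sup norm carried by ['rV_d], although the map
   itself only contracts the Euclidean one. *)
Lemma sqsum_contraction_fixpoint (R : realType) (d : nat)
    (g : 'rV[R]_d -> 'rV[R]_d) (r : R) :
  0 <= r -> r < 1 -> (forall x y, sqsum (g x - g y) <= r * sqsum (x - y)) ->
  exists x, g x = x.
Proof.
move=> r0 r1 gr.
have gk k x y : sqsum (iter k g x - iter k g y) <= r ^+ k * sqsum (x - y).
  elim: k => [|k IH]; first by rewrite expr0 mul1r.
  rewrite !iterS exprS -mulrA (le_trans (gr _ _))//.
  by rewrite ler_wpM2l.
(* Comparing the two norms costs a factor [d] on squares, so this [k] makes the iterate a
   contraction of ratio 1/2 in the sup norm. *)
have [k rk] : exists k, r ^+ k * d%:R <= 2^-1 ^+ 2.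
  have : r ^+ n * d%:R @[n --> \oo] --> (0 : R).
    rewrite -[X in _ --> X](mul0r (d%:R : R)).
    by apply: cvgMl; apply: cvg_expr; rewrite ger0_norm.
  move=> /cvgrPdist_le /(_ (2^-1 ^+ 2)) []; first by rewrite exprn_gt0.
  move=> k _ /(_ k (leqnn k)) /=; rewrite sub0r normrN => h.
  by exists k; apply: le_trans h; rewrite ler_norm.
have lipk x y : `|iter k g x - iter k g y| <= 2^-1 * `|x - y|.
  rewrite -ler_sqr ?nnegrE//.
  rewrite (le_trans (norm_sqsum _))// (le_trans (gk _ _ _))//.
  rewrite exprMn (le_trans (ler_wpM2l _ (sqsum_norm _)))// ?exprn_ge0//.
  by rewrite mulrA ler_wpM2r// exprn_ge0.
have funk : set_fun [set: 'rV[R]_d] [set: 'rV[R]_d] (iter k g) by [].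
pose gK : {fun [set: 'rV[R]_d] >-> [set: 'rV[R]_d]} := mkfun funk.
have ctr : is_contraction gK.
  exists (2^-1%:nng); split=> /=; first by rewrite invf_lt1// ltr1n.
  by move=> [x y] _ /=; exact: lipk.
have [||p _ pE] := banach_fixed_point ctr; [exact: closedT|by exists 0|].
exists p; apply/eqP; rewrite -subr_eq0 -normr_le0.
(* Here [p] is fixed by the iterate. As [g] commutes with its iterates, [g p] is fixed too, and the
   contraction estimate applied to [g p] and [p] forces them to agree. *)
suff : `|g p - p| <= 2^-1 * `|g p - p| by move: `|_| => t h; lra.
have := lipk (g p) p.
by rewrite -iterSr iterS -[iter k g p]pE.
Qed.

(** Zeros of [F] are the fixed points of the damped step [x - t *: F x]. Its squared contraction
    factor is at most [1 - 2 * t * c + t ^+ 2 * M], smallest at [t = c / M], where it equals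
    [1 - c ^+ 2 / M]. *)
Lemma strongly_monotone_zero (R : realType) (d : nat)
    (F : 'rV[R]_d -> 'rV[R]_d) (c L : R) : 0 < c ->
  (forall x y, c * sqsum (x - y)
    <= \sum_(i < d) (F x - F y) 0 i * (x - y) 0 i) ->
  (forall x y, sqsum (F x - F y) <= L * sqsum (x - y)) ->
  exists x, F x = 0.
Proof.
move=> c0 mono lip.
(* The Lipschitz constant is enlarged so that it is positive and [c ^+ 2 / M] does not exceed 1,
   whatever the sign of [L]. *)
pose M := `|L| + c ^+ 2.
have M0 : 0 < M by rewrite ltr_wpDl// exprn_gt0.
have c2M : c ^+ 2 <= M by rewrite lerDr.
have lipM x y : sqsum (F x - F y) <= M * sqsum (x - y).
  rewrite (le_trans (lip _ _))// ler_wpM2r ?sqsum_ge0//.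
  by rewrite (le_trans (ler_norm _))// lerDl sqr_ge0.
pose g x := x - (c / M) *: F x.
have [||x y|x gx] := @sqsum_contraction_fixpoint _ _ g (1 - c ^+ 2 / M).
- by rewrite subr_ge0 ler_pdivrMr// mul1r.
- by rewrite ltrBlDr ltrDl divr_gt0// exprn_gt0.
- have -> : sqsum (g x - g y) = sqsum (x - y)
      - 2 * (c / M) * (\sum_(i < d) (F x - F y) 0 i * (x - y) 0 i)
      + (c / M) ^+ 2 * sqsum (F x - F y).
    rewrite /sqsum !mulr_sumr -sumrB -big_split/=; apply: eq_bigr => i _.
    by rewrite !mxE; ring.
  set E := sqsum (x - y); set I := \sum_(i < d) _.
  have hI : c * E <= I by exact: mono.
  have hF : sqsum (F x - F y) <= M * E by exact: lipM.
  have cM0 : 0 <= c / M by rewrite divr_ge0 ?ltW.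
  have h1 : (c / M) * (c * E) <= (c / M) * I by rewrite ler_wpM2l.
  have h2 : (c / M) ^+ 2 * sqsum (F x - F y) <= (c / M) ^+ 2 * (M * E).
    by rewrite ler_wpM2l// sqr_ge0.
  have h3 : (c / M) ^+ 2 * (M * E) = c ^+ 2 / M * E.
    by rewrite [LHS]mulrA; congr (_ * _); field; rewrite gt_eqF.
  have h4 : (c / M) * (c * E) = c ^+ 2 / M * E by field; rewrite gt_eqF.
  rewrite mulrBl mul1r; lra.
- exists x; move: gx; rewrite /g => /eqP; rewrite -subr_eq0 addrAC subrr sub0r.
  by rewrite oppr_eq0 scaler_eq0 mulf_eq0 invr_eq0 !gt_eqF//= => /eqP.
Qed.

(** * Galerkin equations for strongly monotone operators *)

Section abstract_galerkin.
Context {R : realType} {W : lmodType R}.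

Definition subspace_pred (P : W -> Prop) :=
  P 0 /\ forall c x y, P x -> P y -> P (c *: x + y).

Definition linear_on (P : W -> Prop) (l : W -> R) :=
  forall c x y, P x -> P y -> l (c *: x + y) = c * l x + l y.

(* [coef] need not be linear: for a finite element space it is a choice of
   coefficients on every cell. *)
Definition coef_independent (P : W -> Prop) (m : nat) (coef : W -> 'rV[R]_m) :=
  forall d (e : 'I_d -> W) (y : 'I_d -> R), (forall i, P (e i)) ->
    \sum_(i < d) y i *: coef (e i) = 0 -> \sum_(i < d) y i *: e i = 0.

Definition inner_product_on (P : W -> Prop) (Q : W -> W -> R) :=
  [/\ forall z, P z -> linear_on P (Q^~ z),
      forall x y, Q x y = Q y x,
      forall x, P x -> 0 <= Q x x &
      forall x, P x -> Q x x = 0 -> x = 0].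

Lemma linear_on0 P l : subspace_pred P -> linear_on P l -> l 0 = 0.
Proof.
move=> [P0 _] /(_ (-1) 0 0 P0 P0); rewrite scaler0 addr0 mulN1r => ->.
by rewrite addNr.
Qed.

Lemma linear_onB P l x y : linear_on P l -> P x -> P y -> l (x - y) = l x - l y.
Proof. by move=> ll Px Py; rewrite addrC -scaleN1r ll// mulN1r addrC. Qed.

Lemma linear_onZ P l c x : subspace_pred P -> linear_on P l -> P x ->
  l (c *: x) = c * l x.
Proof.
move=> sP ll Px; rewrite -[c *: x]addr0 ll//; last by case: sP.
by rewrite (linear_on0 sP ll) addr0.
Qed.

Lemma subspace_predB P x y : subspace_pred P -> P x -> P y -> P (x - y).
Proof. by move=> [_ cP] Px Py; rewrite addrC -scaleN1r; exact: cP. Qed.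

Lemma subspace_predZ P c x : subspace_pred P -> P x -> P (c *: x).
Proof. by move=> [P0 cP] Px; rewrite -[_ *: _]addr0; exact: cP. Qed.

Lemma subspace_pred_sum P d (y : 'I_d -> R) (e : 'I_d -> W) :
  subspace_pred P -> (forall i, P (e i)) -> P (\sum_(i < d) y i *: e i).
Proof.
move=> [P0 cP] Pe; elim/big_rec: _ => [//|i x _ Px]; exact: cP.
Qed.

Lemma linear_on_sum P l d (y : 'I_d -> R) (e : 'I_d -> W) :
  subspace_pred P -> linear_on P l -> (forall i, P (e i)) ->
  l (\sum_(i < d) y i *: e i) = \sum_(i < d) y i * l (e i).
Proof.
move=> sP ll Pe.
suff [] : P (\sum_(i < d) y i *: e i) /\
  l (\sum_(i < d) y i *: e i) = \sum_(i < d) y i * l (e i) by [].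
elim/big_rec2: _ => [|i x z _ [Pz <-]].
  by split; [case: sP|exact: linear_on0 sP ll].
by split; [case: sP => _; exact|rewrite ll].
Qed.

Definition orthonormal_in (P : W -> Prop) (Q : W -> W -> R) d (e : 'I_d -> W) :=
  (forall i, P (e i)) /\ forall i j, Q (e i) (e j) = (i == j)%:R.

Lemma orthonormal_in_sum P Q d (e : 'I_d -> W) (y : 'I_d -> R) j :
  subspace_pred P -> inner_product_on P Q -> orthonormal_in P Q e ->
  Q (\sum_(i < d) y i *: e i) (e j) = y j.
Proof.
move=> sP [linQ _ _ _] [Pe orth].
rewrite (linear_on_sum _ sP (linQ _ (Pe j)) Pe) (bigD1 j)//= orth eqxx mulr1.
by rewrite big1 ?addr0// => i ij; rewrite orth (negbTE ij) mulr0.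
Qed.

(** The coefficient rows of an orthonormal family are independent: a relation between them lifts to
    the vectors, and pairing that with [e j] kills the j-th weight. The rank is at most [m]. *)
Lemma orthonormal_in_size P Q m (coef : W -> 'rV[R]_m) d (e : 'I_d -> W) :
  subspace_pred P -> inner_product_on P Q -> coef_independent P coef ->
  orthonormal_in P Q e -> (d <= m)%N.
Proof.
move=> sP iQ ind oe.
pose C : 'M[R]_(d, m) := \matrix_(i < d) coef (e i).
suff : row_free C by rewrite /row_free => /eqP <-; exact: rank_leq_col.
rewrite -kermx_eq0; apply/eqP/row_matrixP => i; rewrite row0.
set y := row i _.
have yC : y *m C = 0 by rewrite /y -row_mul mulmx_ker row0.
have /(ind _ _ _ oe.1) e0 : \sum_(k < d) y 0 k *: coef (e k) = 0.
  by rewrite -[RHS]yC mulmx_sum_row; apply: eq_bigr => k _; rewrite rowK.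
apply/rowP => j; rewrite [RHS]mxE -(orthonormal_in_sum (y 0) j sP iQ oe) e0.
by case: (iQ) => linQ _ _ _; rewrite (linear_on0 sP (linQ _ (oe.1 j))).
Qed.

(** A family of maximal length spans. Otherwise some [w] differs from its projection, and the
    normalised residual, put at index 0, gives a longer orthonormal family. *)
Lemma orthonormal_basis P Q m (coef : W -> 'rV[R]_m) :
  subspace_pred P -> inner_product_on P Q -> coef_independent P coef ->
  exists d (e : 'I_d -> W), orthonormal_in P Q e /\
    forall w, P w -> w = \sum_(i < d) Q w (e i) *: e i.
Proof.
move=> sP iQ ind.
pose has d := `[< exists e : 'I_d -> W, orthonormal_in P Q e >].
have ex0 : exists d, has d.
  exists 0%N; apply/asboolP; exists (fun=> 0); split=> [i|i]; last by case: i.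
  by case: sP.
have bnd d : has d -> (d <= m)%N.
  by move=> /asboolP [e oe]; exact: (orthonormal_in_size sP iQ ind oe).
case: (ex_maxnP ex0 bnd) => d /asboolP [e oe] dmax.
exists d, e; split=> // w Pw; apply: contrapT => wne.
have [linQ symQ posQ defQ] := iQ.
have [Pe orth] := oe.
pose p := \sum_(i < d) Q w (e i) *: e i.
have Pp : P p by exact: subspace_pred_sum.
pose z := w - p.
have Pz : P z by exact: subspace_predB.
have zne : z != 0 by rewrite subr_eq0; apply/eqP.
have Qz i : Q z (e i) = 0.
  by rewrite (linear_onB (linQ _ (Pe i)))// (orthonormal_in_sum _ _ sP iQ oe) subrr.
have Qzz : 0 < Q z z.
  by rewrite lt_neqAle posQ// andbT eq_sym; apply/eqP => /(defQ _ Pz)/eqP; rewrite (negbTE zne).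
pose s := Num.sqrt (Q z z).
have s0 : 0 < s by rewrite sqrtr_gt0.
pose f := s^-1 *: z.
have Pf : P f by exact: subspace_predZ.
have Qf i : Q f (e i) = 0.
  by rewrite (linear_onZ _ sP (linQ _ (Pe i)))// Qz mulr0.
have Qff : Q f f = 1.
  rewrite (linear_onZ _ sP (linQ _ Pf))// symQ (linear_onZ _ sP (linQ _ Pz))//.
  rewrite mulrA -expr2 exprVn sqr_sqrtr; last exact: ltW.
  by rewrite mulVf// gt_eqF.
suff /dmax : has d.+1 by rewrite ltnn.
apply/asboolP.
exists (fun i => if unlift ord0 i is Some j then e j else f); split=> [i|i j].
  by case: unliftP.
case: (unliftP ord0 i) => [i' ->|->]; case: (unliftP ord0 j) => [j' ->|->] /=.
- by rewrite orth (inj_eq (@lift_inj _ _)).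
- by rewrite symQ Qf.
- by rewrite Qf.
- by rewrite Qff.
Qed.

(* Galerkin form of the Zarantonello theorem: in a Q-orthonormal basis the
   operator becomes a Lipschitz, strongly monotone map of R^d. *)
Lemma strongly_monotone_solvable P Q m (coef : W -> 'rV[R]_m)
    (a b : W -> W -> R) (nu : W -> R) (c : R) :
  subspace_pred P -> inner_product_on P Q -> coef_independent P coef ->
  0 < c ->
  (forall x, P x -> linear_on P (a x)) ->
  (forall x y, P x -> P y -> c * Q (x - y) (x - y) <= a x (x - y) - a y (x - y)) ->
  (forall v, P v -> linear_on P (b^~ v)) ->
  (forall s x, P x -> nu (s *: x) <= `|s| * nu x) ->
  (forall x y, P x -> P y -> nu (x + y) <= nu x + nu y) ->
  (forall v, P v -> exists2 C, 0 <= C & forall x y, P x -> P y ->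
    `|a x v - a y v - b (x - y) v| <= C * nu (x - y)) ->
  exists2 x, P x & forall v, P v -> a x v = 0.
Proof.
move=> sP iQ ind c0 lina mono linb nuZ nuD lip.
have [d [e [oe span]]] := orthonormal_basis sP iQ ind.
have [linQ symQ posQ defQ] := iQ.
have [Pe orth] := oe.
pose X (y : 'rV[R]_d) := \sum_(i < d) y 0 i *: e i.
have PX y : P (X y) by exact: subspace_pred_sum.
have XB y y' : X y - X y' = X (y - y').
  by rewrite /X -sumrB; apply: eq_bigr => i _; rewrite !mxE scalerBl.
have QX y : Q (X y) (X y) = sqsum y.
  rewrite /X (linear_on_sum _ sP (linQ _ (PX y)) Pe); apply: eq_bigr => i _.
  by rewrite symQ (orthonormal_in_sum _ _ sP iQ oe) expr2.
have nu0 : nu 0 <= 0.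
  by have := nuZ 0 0 sP.1; rewrite scale0r normr0 mul0r.
(* A subadditive, homogeneous bound is controlled by the coordinates, so [nu] never has to be
   compared with [Q]. *)
have nuX y : nu (X y) <= \sum_(i < d) `|y 0 i| * nu (e i).
  suff [] : P (X y) /\ nu (X y) <= \sum_(i < d) `|y 0 i| * nu (e i) by [].
  rewrite /X; elim/big_rec2: _ => [|i s x _ [Px xs]]; first by split; [case: sP|].
  split; first by case: sP => _; exact.
  rewrite (le_trans (nuD _ _ _ _))//; first exact: subspace_predZ.
  by rewrite lerD// nuZ.
have /choice [C0 lipC] : forall i, exists C, 0 <= C /\
   forall x y, P x -> P y ->
    `|a x (e i) - a y (e i) - b (x - y) (e i)| <= C * nu (x - y).
  by move=> i; have [C ? ?] := lip _ (Pe i); exists C.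
pose F (y : 'rV[R]_d) : 'rV[R]_d := \row_i a (X y) (e i).
(* The constant of [lip] may depend on the test vector. Only the [d] basis vectors are tested, so
   summing over them gives one uniform constant. *)
pose D := \sum_(i < d) \sum_(j < d) (`|b (e j) (e i)| + C0 i * `|nu (e j)|).
have D0 : 0 <= D.
  apply: sumr_ge0 => i _; apply: sumr_ge0 => j _.
  by rewrite addr_ge0// mulr_ge0//; case: (lipC i).
have lipF y y' i : `|(F y - F y') 0 i| <= D * `|y - y'|.
  have yj j : `|(y - y') 0 j| <= `|y - y'|.
    have -> : `|y - y'| = mx_norm (y - y') by [].
    rewrite mx_normrE.
    exact: (le_bigmax _ (fun ij : 'I_1 * 'I_d => `|(y - y') ij.1 ij.2|) (0, j)).
  have [C00 /(_ _ _ (PX y) (PX y'))] := lipC i.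
  rewrite XB => l1.
  have l2 : `|b (X (y - y')) (e i)| <= (\sum_(j < d) `|b (e j) (e i)|) * `|y - y'|.
    rewrite /X (linear_on_sum _ sP (linb _ (Pe i)) Pe) (le_trans (ler_norm_sum _ _ _))//.
    by rewrite mulr_suml ler_sum// => j _; rewrite normrM mulrC ler_wpM2l.
  have l3 : C0 i * nu (X (y - y')) <= (\sum_(j < d) C0 i * `|nu (e j)|) * `|y - y'|.
    rewrite -mulr_sumr -mulrA ler_wpM2l// (le_trans (nuX _))// mulr_suml ler_sum// => j _.
    by rewrite mulrC (le_trans (ler_wpM2r _ (ler_norm _)))// ler_wpM2l.
  have DE : \sum_(j < d) (`|b (e j) (e i)| + C0 i * `|nu (e j)|) <= D.
    rewrite /D [leRHS](bigD1 i)//= lerDl; apply: sumr_ge0 => k _; apply: sumr_ge0 => j _.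
    by rewrite addr_ge0// mulr_ge0//; case: (lipC k).
  rewrite (le_trans _ (ler_wpM2r _ DE))// big_split/= mulrDl.
  rewrite !mxE -[_ - _](subrK (b (X (y - y')) (e i))).
  by rewrite (le_trans (ler_normD _ _))// addrC lerD// (le_trans l1).
have [y Fy] : exists y, F y = 0.
  (* The entrywise bound by [D] becomes a bound on [sqsum] at the cost of the factor [d]. *)
  apply: (@strongly_monotone_zero _ _ F c (d%:R * D ^+ 2)) => // [y y'|y y'].
    rewrite -QX -XB (le_trans (mono _ _ (PX y) (PX y')))//.
    rewrite !XB /X.
    rewrite (linear_on_sum _ sP (lina _ (PX y)) Pe).
    rewrite (linear_on_sum _ sP (lina _ (PX y')) Pe) -sumrB.
    by apply: ler_sum => i _; rewrite !mxE -mulrBr mulrC.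
  rewrite (le_trans (sqsum_norm _))// -mulrA ler_wpM2l//.
  rewrite (le_trans _ (ler_wpM2l (sqr_ge0 D) (norm_sqsum _)))// -exprMn.
  rewrite ler_sqr ?nnegrE ?mulr_ge0//.
  have -> : `|F y - F y'| = mx_norm (F y - F y') by [].
  have [->|/mx_norm_neq0 [[i j] ->]] := eqVneq (mx_norm (F y - F y')) 0.
    by rewrite mulr_ge0.
  by rewrite /= ord1; exact: lipF.
exists (X y) => // v Pv; rewrite [v]span// (linear_on_sum _ sP (lina _ (PX y)) Pe).
apply: big1 => i _.
by move/rowP: Fy => /(_ i); rewrite !mxE => ->; rewrite mulr0.
Qed.

End abstract_galerkin.

(** * Quadratic polynomials and triangles in the plane *)

Section plane.
Context {R : realType}.
Local Notation pt := (@pt R).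
Implicit Types (x y : pt) (t : @tri R) (k : nat -> R) (Th : seq (@tri R)).

Lemma nbhs_box (U : set pt) x : nbhs x U <-> exists2 e : R, 0 < e &
  forall y, `|x.1 - y.1| < e -> `|x.2 - y.2| < e -> U y.
Proof.
split=> [/nbhs_ballP [e /= e0 eU]|[e e0 eU]].
  by exists e => // y y1 y2; apply: eU; split.
by apply/nbhs_ballP; exists e => //= y [y1 y2]; exact: eU.
Qed.

Lemma open_box (U : set pt) x : open U -> U x -> exists2 e : R, 0 < e &
  forall y, `|x.1 - y.1| < e -> `|x.2 - y.2| < e -> U y.
Proof. by move=> oU Ux; apply/nbhs_box; exact: open_nbhs_nbhs. Qed.

Lemma measurable_box (a b r : R) :
  measurable [set x : pt | `|a - x.1| < r /\ `|b - x.2| < r].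
Proof.
have -> : [set x : pt | `|a - x.1| < r /\ `|b - x.2| < r] =
    (ball a r : set R) `*` (ball b r : set R) by [].
by apply: measurableX; apply: open_measurable; exact: ball_open.
Qed.

(** The sigma-algebra is the product one, so it is boxes that are known to be measurable; an open
    set is the union of the countably many rational boxes inside it. *)
Lemma open_measurable_plane (U : set pt) : open U -> measurable U.
Proof.
move=> oU.
pose B (i : rat * rat * rat) :=
  [set x : pt | `|ratr i.1.1 - x.1| < ratr i.2 /\ `|ratr i.1.2 - x.2| < ratr i.2].
have -> : U = \bigcup_(i in [set i | B i `<=` U]) B i.
  apply/seteqP; split=> [x Ux|x [i /= BU Bx]]; last exact: BU.
  have [e e0 eU] := open_box oU Ux.
  (* A box of half-width [r] that contains [x] stays within [2 * r] of [x], hence the bound [e / 2]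
     on the rational half-width. *)
  have e2 : 0 < e / 2 by rewrite divr_gt0.
  have /rat_in_itvoo[r] := e2; rewrite in_itv /= => /andP[r0 re].
  have /rat_in_itvoo[p] : x.1 - ratr r < x.1 + ratr r by rewrite ltrBlDr -addrA ltrDl addr_gt0.
  have /rat_in_itvoo[q] : x.2 - ratr r < x.2 + ratr r by rewrite ltrBlDr -addrA ltrDl addr_gt0.
  rewrite !in_itv/= => /andP[q1 q2] /andP[p1 p2].
  have px : `|ratr p - x.1| < ratr r by rewrite ltr_norml; apply/andP; split; lra.
  have qx : `|ratr q - x.2| < ratr r by rewrite ltr_norml; apply/andP; split; lra.
  exists (p, q, r) => //= y [/= y1 y2]; apply: eU.
    rewrite -(subrK (ratr p) x.1) -addrA (le_lt_trans (ler_normD _ _))//.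
    by rewrite distrC; lra.
  rewrite -(subrK (ratr q) x.2) -addrA (le_lt_trans (ler_normD _ _))//.
  by rewrite distrC; lra.
rewrite bigcup_mkcond.
apply: countable_bigcupT_measurable => [|i]; first exact: countableP.
by case: ifP => _ //; exact: measurable_box.
Qed.

(* Coefficients are ordered as in [P2_on]. *)
Definition p2 k x : R := k 0%N + k 1%N * x.1 + k 2%N * x.2 + k 3%N * x.1 ^+ 2
  + k 4%N * (x.1 * x.2) + k 5%N * x.2 ^+ 2.

Definition dp2 (j : 'I_2) k x : R :=
  if j == ord0 then k 1%N + 2 * k 3%N * x.1 + k 4%N * x.2
  else k 2%N + k 4%N * x.1 + 2 * k 5%N * x.2.

Lemma P2_onP (S : set pt) (f : pt -> R) :
  P2_on S f <-> exists k, forall x, S x -> f x = p2 k x.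
Proof.
split=> [[c0 [c1 [c2 [c3 [c4 [c5 h]]]]]]|[k h]].
  by exists (fun i => nth 0 [:: c0; c1; c2; c3; c4; c5] i).
by exists (k 0%N), (k 1%N), (k 2%N), (k 3%N), (k 4%N), (k 5%N).
Qed.

Lemma continuous_coord1 : continuous (fun x : pt => x.1).
Proof. by move=> x; exact: cvg_fst. Qed.

Lemma continuous_coord2 : continuous (fun x : pt => x.2).
Proof. by move=> x; exact: cvg_snd. Qed.

Lemma continuous_p2 k : continuous (p2 k).
Proof.
move=> x; have c1 := @continuous_coord1 x; have c2 := @continuous_coord2 x.
rewrite /continuous_at /p2; under eq_fun do rewrite !expr2.
by do ![exact: c1 | exact: c2 | exact: cvg_cst | apply: cvgD | apply: cvgM].
Qed.

Lemma dp2_p2 j k : exists k', dp2 j k = p2 k'.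
Proof.
rewrite /dp2; case: (j == ord0).
  exists (fun i => nth 0 [:: k 1%N; 2 * k 3%N; k 4%N] i); apply/funext => x.
  by rewrite /p2/=; ring.
exists (fun i => nth 0 [:: k 2%N; k 4%N; 2 * k 5%N] i); apply/funext => x.
by rewrite /p2/=; ring.
Qed.

Lemma measurable_p2 k (D : set pt) : measurable_fun D (p2 k).
Proof.
apply: measurable_funTS.
have m1 : measurable_fun setT (fun x : pt => x.1) by exact: measurable_fst.
have m2 : measurable_fun setT (fun x : pt => x.2) by exact: measurable_snd.
by do ![apply: measurable_funD | apply: measurable_funM | apply: measurable_funX |
  exact: measurable_cst | exact: m1 | exact: m2].
Qed.

Lemma p2D k k' c x : p2 (fun i => c * k i + k' i) x = c * p2 k x + p2 k' x.
Proof. by rewrite /p2; ring. Qed.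

Lemma dp2D j k k' c x : dp2 j (fun i => c * k i + k' i) x = c * dp2 j k x + dp2 j k' x.
Proof. by rewrite /dp2; case: ifP => _; ring. Qed.

Lemma p2_bounded k (M : R) (x : pt) : `|x.1| <= M -> `|x.2| <= M ->
  `|p2 k x| <= `|k 0%N| + (`|k 1%N| + `|k 2%N|) * M
     + (`|k 3%N| + `|k 4%N| + `|k 5%N|) * M ^+ 2.
Proof.
move=> x1 x2; have M0 : 0 <= M by rewrite (le_trans _ x1).
have tri a b (A B : R) : `|a| <= A -> `|b| <= B -> `|a + b| <= A + B.
  by move=> aA bB; rewrite (le_trans (ler_normD _ _))// lerD.
rewrite !mulrDl !addrA /p2.
have h (c z Z : R) : `|z| <= Z -> `|c * z| <= `|c| * Z.
  by move=> zZ; rewrite normrM ler_wpM2l.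
by do 5![apply: (tri); last by apply: (h); rewrite // expr2 normrM ler_pM].
Qed.

(* Barycentric coordinates of [x] with respect to [t]. *)
Definition tdet t : R := ((tv2 t).1 - (tv1 t).1) * ((tv3 t).2 - (tv1 t).2)
  - ((tv3 t).1 - (tv1 t).1) * ((tv2 t).2 - (tv1 t).2).
Definition bar2 t x : R := ((x.1 - (tv1 t).1) * ((tv3 t).2 - (tv1 t).2)
  - ((tv3 t).1 - (tv1 t).1) * (x.2 - (tv1 t).2)) / tdet t.
Definition bar3 t x : R := (((tv2 t).1 - (tv1 t).1) * (x.2 - (tv1 t).2)
  - (x.1 - (tv1 t).1) * ((tv2 t).2 - (tv1 t).2)) / tdet t.
Definition bar1 t x : R := 1 - bar2 t x - bar3 t x.

Lemma bar_comb3 t (l1 l2 l3 : R) : Defs.nondegenerate t -> l1 + l2 + l3 = 1 ->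
  let x := comb3 (tv1 t) (tv2 t) (tv3 t) l1 l2 l3 in
  [/\ bar1 t x = l1, bar2 t x = l2 & bar3 t x = l3].
Proof.
rewrite /Defs.nondegenerate -/(tdet t) => nd ls; set x := comb3 _ _ _ _ _ _.
have e1 : l1 = 1 - l2 - l3 by rewrite -ls; ring.
have b2 : bar2 t x = l2.
  by rewrite /bar2 /x /comb3 /= e1; apply: (mulIf nd); rewrite divfK// /tdet; ring.
have b3 : bar3 t x = l3.
  by rewrite /bar3 /x /comb3 /= e1; apply: (mulIf nd); rewrite divfK// /tdet; ring.
by split=> //; rewrite /bar1 b2 b3 e1.
Qed.

Lemma comb3_bar t x : Defs.nondegenerate t ->
  x = comb3 (tv1 t) (tv2 t) (tv3 t) (bar1 t x) (bar2 t x) (bar3 t x).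
Proof.
rewrite /Defs.nondegenerate -/(tdet t) => nd.
rewrite [LHS]surjective_pairing /comb3 /bar1 /bar2 /bar3; congr (_, _);
  by apply: (mulIf nd); rewrite !(mulrDl, mulrBl) mul1r -!mulrA; do ?rewrite (mulrC _ (tdet t));
     rewrite /tdet; field; rewrite -/(tdet t).
Qed.

Lemma tri_setE t : Defs.nondegenerate t ->
  tri_set t = [set x | [/\ 0 <= bar1 t x, 0 <= bar2 t x & 0 <= bar3 t x]].
Proof.
move=> nd; apply/seteqP; split=> [x [l1 [l2 [l3 [h1 h2 h3 ls ->]]]]|x [h1 h2 h3]] /=.
  by have [-> -> ->] := bar_comb3 nd ls.
exists (bar1 t x), (bar2 t x), (bar3 t x); split=> //; last exact: comb3_bar.
by rewrite /bar1; ring.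
Qed.

Lemma otri_setE t : Defs.nondegenerate t ->
  otri_set t = [set x | [/\ 0 < bar1 t x, 0 < bar2 t x & 0 < bar3 t x]].
Proof.
move=> nd; apply/seteqP; split=> [x [l1 [l2 [l3 [h1 h2 h3 ls ->]]]]|x [h1 h2 h3]] /=.
  by have [-> -> ->] := bar_comb3 nd ls.
exists (bar1 t x), (bar2 t x), (bar3 t x); split=> //; last exact: comb3_bar.
by rewrite /bar1; ring.
Qed.

Lemma otri_sub_tri t : otri_set t `<=` tri_set t.
Proof.
by move=> x [l1 [l2 [l3 [h1 h2 h3 ls ->]]]]; exists l1, l2, l3; split=> //; exact: ltW.
Qed.

(** Makes a triangle an intersection of polynomial inequalities, so that openness and measurability
    of cells reduce to those of sets defined by [p2]. *)
Lemma bar_p2 t : [/\ exists k, bar1 t = p2 k, exists k, bar2 t = p2 k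
  & exists k, bar3 t = p2 k].
Proof.
pose d := (tdet t)^-1; pose a := tv1 t; pose b := tv2 t; pose c := tv3 t.
pose s2 := [:: (- a.1 * (c.2 - a.2) + (c.1 - a.1) * a.2) * d; (c.2 - a.2) * d; - (c.1 - a.1) * d].
pose s3 := [:: (- (b.1 - a.1) * a.2 + a.1 * (b.2 - a.2)) * d; - (b.2 - a.2) * d; (b.1 - a.1) * d].
have e2 : bar2 t = p2 (fun i => s2`_i).
  by apply/funext => x; rewrite /bar2 /p2 /s2 -/d /= -/a -/b -/c; ring.
have e3 : bar3 t = p2 (fun i => s3`_i).
  by apply/funext => x; rewrite /bar3 /p2 /s3 -/d /= -/a -/b -/c; ring.
split; [|by eexists; exact: e2|by eexists; exact: e3].
exists (fun i => (i == 0)%:R - s2`_i - s3`_i); apply/funext => x.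
by rewrite /bar1 e2 e3 /p2 /=; ring.
Qed.

Lemma open_pos_p2 k : open [set x : pt | 0 < p2 k x].
Proof.
have -> : [set x : pt | 0 < p2 k x] = p2 k @^-1` [set r | 0 < r] by [].
by apply: open_comp; [move=> x _; exact: continuous_p2|exact: open_gt].
Qed.

Lemma otri_open t : Defs.nondegenerate t -> open (otri_set t).
Proof.
move=> nd; rewrite otri_setE//; have [[k1 ->] [k2 ->] [k3 ->]] := bar_p2 t.
have -> : [set x | [/\ 0 < p2 k1 x, 0 < p2 k2 x & 0 < p2 k3 x]] =
  [set x | 0 < p2 k1 x] `&` [set x | 0 < p2 k2 x] `&` [set x | 0 < p2 k3 x].
  by apply/seteqP; split=> x /= => [[]|[[]]].
by do 2?[apply: openI]; exact: open_pos_p2.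
Qed.

Lemma measurable_tri t : Defs.nondegenerate t -> measurable (tri_set t).
Proof.
move=> nd; rewrite tri_setE//; have [[k1 ->] [k2 ->] [k3 ->]] := bar_p2 t.
have mk k : measurable [set x : pt | 0 <= p2 k x].
  have := measurable_p2 k (D := setT) measurableT (measurable_itv `[0, +oo[).
  by rewrite setTI; congr measurable; apply/seteqP; split=> x /=; rewrite in_itv/= andbT.
have -> : [set x | [/\ 0 <= p2 k1 x, 0 <= p2 k2 x & 0 <= p2 k3 x]] =
  [set x | 0 <= p2 k1 x] `&` [set x | 0 <= p2 k2 x] `&` [set x | 0 <= p2 k3 x].
  by apply/seteqP; split=> x /= => [[]|[[]]].
by do 2?[apply: measurableI]; exact: mk.
Qed.

Lemma measurable_otri t : Defs.nondegenerate t -> measurable (otri_set t).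
Proof. by move=> /otri_open; exact: open_measurable_plane. Qed.

Lemma tri_set_bounded t : exists M : R, forall x, tri_set t x -> `|x.1| <= M /\ `|x.2| <= M.
Proof.
pose a := tv1 t; pose b := tv2 t; pose c := tv3 t.
exists (`|a.1| + `|b.1| + `|c.1| + (`|a.2| + `|b.2| + `|c.2|)).
move=> x [l1 [l2 [l3 [h1 h2 h3 ls ->]]]]; rewrite /comb3 /= -/a -/b -/c.
have h (p q r : R) : `|l1 * p + l2 * q + l3 * r| <= `|p| + `|q| + `|r|.
  have aux (l s : R) : 0 <= l -> l <= 1 -> `|l * s| <= `|s|.
    by move=> l0 l1'; rewrite normrM ger0_norm// ler_piMl.
  rewrite (le_trans (ler_normD _ _))// lerD ?aux//; last by lra.
  by rewrite (le_trans (ler_normD _ _))// lerD ?aux//; lra.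
by split; rewrite (le_trans (h _ _ _))// ?lerDl ?lerDr !addr_ge0.
Qed.

End plane.

(** * Classical partial derivatives inside a cell *)

Section cell_derivative.
Context {R : realType}.
Local Notation pt := (@pt R).

Lemma derive1_quadratic (f : R -> R) (a b c x : R) :
  (\forall s \near x, f s = a + b * s + c * s ^+ 2) -> derive1 f x = b + 2 * c * x.
Proof.
move=> fE; rewrite derive1E.
have : is_derive x (1 : R) (fun s : R => a + b * s + c * s ^+ 2) (b + 2 * c * x).
  by apply: is_derive_eq; rewrite /GRing.scale/=; ring.
by move=> [_ <-]; exact: near_eq_derive.
Qed.

(** Differentiation is local: a box around [x] lies in the open cell, so along each coordinate line
    [f] coincides near [x] with the quadratic of that cell. *)
Lemma pd_p2 (Th : seq (@tri R)) (t : @tri R) j (f : pt -> R) k x :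
  t \in Th -> Defs.nondegenerate t -> (forall y, tri_set t y -> f y = p2 k y) ->
  otri_set t x -> pd Th j f x = dp2 j k x.
Proof.
move=> tTh nd fk tx; rewrite /pd.
have -> : `[< exists2 t, t \in Th & otri_set t x >] by apply/asboolP; exists t.
have [e e0 ebox] := open_box (otri_open nd) tx.
rewrite /dp2; case: ifP => _.
  rewrite (@derive1_quadratic _ (k 0%N + k 2%N * x.2 + k 5%N * x.2 ^+ 2)
      (k 1%N + k 4%N * x.2) (k 3%N)); first by ring.
  apply/nbhs_ballP; exists e => //= s se; rewrite fk; first by rewrite /p2 /=; ring.
  by apply: otri_sub_tri; apply: ebox => //=; rewrite subrr normr0.
rewrite (@derive1_quadratic _ (k 0%N + k 1%N * x.1 + k 3%N * x.1 ^+ 2)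
    (k 2%N + k 4%N * x.1) (k 5%N)); first by ring.
apply/nbhs_ballP; exists e => //= s se; rewrite fk; first by rewrite /p2 /=; ring.
by apply: otri_sub_tri; apply: ebox => //=; rewrite subrr normr0.
Qed.

Lemma pd_out (Th : seq (@tri R)) j (f : pt -> R) x :
  ~ (exists2 t, t \in Th & otri_set t x) -> pd Th j f x = 0.
Proof. by move=> h; rewrite /pd; case: asboolP. Qed.

End cell_derivative.

(** * Broken polynomials and bounded measurable functions *)

Section piecewise.
Context {R : realType}.
Local Notation pt := (@pt R).

Lemma piecewise_measurable (s : seq (@tri R)) (A : @tri R -> set pt) (f : pt -> R) :
  (forall t, t \in s -> measurable (A t)) ->
  (forall t, t \in s -> measurable_fun (A t) f) ->
  measurable [set x | exists2 t, t \in s & A t x] /\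
  measurable_fun [set x | exists2 t, t \in s & A t x] f.
Proof.
elim: s => [|t s IH] mA mf.
  have -> : [set x | exists2 t, t \in [::] & A t x] = set0.
    by apply/seteqP; split=> x //= [].
  by split=> //; exact: measurable_fun_set0.
have -> : [set x | exists2 t', t' \in t :: s & A t' x] =
    A t `|` [set x | exists2 t', t' \in s & A t' x].
  apply/seteqP; split=> x /=.
    by move=> [t']; rewrite inE => /predU1P[->|ts At]; [left|right; exists t'].
  by move=> [At|[t' ts At]]; [exists t; rewrite ?mem_head|exists t'; rewrite // inE ts orbT].
have [||m1 m2] := IH.
- by move=> t' ts; apply: mA; rewrite inE ts orbT.
- by move=> t' ts; apply: mf; rewrite inE ts orbT.
have mAt := mA _ (mem_head t s); have mft := mf _ (mem_head t s).
by split; [exact: measurableU|apply/measurable_funU].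
Qed.

Lemma piecewise_bounded (s : seq (@tri R)) (A : @tri R -> set pt) (f : pt -> R) :
  (forall t, t \in s -> exists M, forall x, A t x -> `|f x| <= M) ->
  exists M, forall x, (exists2 t, t \in s & A t x) -> `|f x| <= M.
Proof.
elim: s => [|t s IH] bf; first by exists 0 => x [].
have [|M1 h1] := IH; first by move=> t' ts; apply: bf; rewrite inE ts orbT.
have [M2 h2] := bf _ (mem_head t s).
exists (Num.max M1 M2) => x [t']; rewrite inE le_max => /predU1P[->|ts] At.
  by rewrite h2 ?orbT.
by rewrite h1//; exists t'.
Qed.

End piecewise.

Section domain.
Context {R : realType} (Omega : set (@pt R)) (Th : seq (@tri R)).
Hypothesis TO : triangulation Omega Th.
Local Notation pt := (@pt R).
Implicit Types (h f : pt -> R).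

Lemma tri_open : open Omega. Proof. by case: TO => -[]. Qed.
Lemma tri_neq0 : Omega !=set0. Proof. by case: TO => -[]. Qed.
Lemma tri_nondeg t : t \in Th -> Defs.nondegenerate t.
Proof. by case: TO => _ _ _ h _; exact: h. Qed.
Lemma tri_cover x : closure Omega x <-> exists2 t, t \in Th & tri_set t x.
Proof. by case: TO => _ _ -> _ _. Qed.
Lemma tri_Omega_cover x : Omega x -> exists2 t, t \in Th & tri_set t x.
Proof. by move=> Ox; apply/tri_cover; exact: subset_closure. Qed.
Lemma tri_measurable : measurable Omega.
Proof. exact: open_measurable_plane tri_open. Qed.

Lemma tri_bounded : exists M, forall x, closure Omega x -> `|x.1| <= M /\ `|x.2| <= M.
Proof.
have [M1 h1] := @piecewise_bounded _ Th (fun t => tri_set t) (fun x => x.1)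
  (fun t _ => let: ex_intro M h := tri_set_bounded t in ex_intro _ M (fun x tx => (h x tx).1)).
have [M2 h2] := @piecewise_bounded _ Th (fun t => tri_set t) (fun x => x.2)
  (fun t _ => let: ex_intro M h := tri_set_bounded t in ex_intro _ M (fun x tx => (h x tx).2)).
exists (Num.max M1 M2) => x /tri_cover cx.
by rewrite !le_max h1// h2// orbT.
Qed.

Lemma leb2_fin : (leb2 Omega < +oo :> \bar R)%E.
Proof.
have [M hM] := tri_bounded.
pose r : R := `|M| + 1.
have r0 : 0 < r by rewrite ltr_wpDl.
apply: (@le_lt_trans _ _ (leb2 ((ball (0:R) r : set R) `*` (ball (0:R) r : set R)))).
  apply: le_measure; rewrite ?inE; first exact: tri_measurable.
    by apply: measurableX; apply: open_measurable; exact: ball_open.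
  move=> x Ox; have [x1 x2] := hM x (subset_closure Ox).
  split; rewrite /ball/= sub0r normrN /r; first by have := ler_norm M; lra.
  by have := ler_norm M; lra.
rewrite /leb2 product_measure1E; [|by apply: open_measurable; exact: ball_open..].
have fin (a b : \bar R) : a = (r *+ 2)%:E -> b = (r *+ 2)%:E -> (a * b < +oo)%E.
  by move=> -> ->; rewrite -EFinM ltry.
by apply: fin; exact: lebesgue_measure_ball (ltW r0).
Qed.

(** Unlike integrability, this property is stable under products, and on a domain of finite measure
    it implies integrability. It carries all integrability side conditions except those involving
    the square-integrable data. *)
Definition bmeas h := measurable_fun Omega h /\
  exists M, forall x, Omega x -> `|h x| <= M.

Lemma bmeas_cst c : bmeas (fun=> c).
Proof. by split; [exact: measurable_cst|exists `|c|]. Qed.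

Lemma bmeasD h1 h2 : bmeas h1 -> bmeas h2 -> bmeas (fun x => h1 x + h2 x).
Proof.
move=> [m1 [M1 b1]] [m2 [M2 b2]]; split; first exact: measurable_funD.
by exists (M1 + M2) => x Ox; rewrite (le_trans (ler_normD _ _))// lerD ?b1 ?b2.
Qed.

Lemma bmeasM h1 h2 : bmeas h1 -> bmeas h2 -> bmeas (fun x => h1 x * h2 x).
Proof.
move=> [m1 [M1 b1]] [m2 [M2 b2]]; split; first exact: measurable_funM.
by exists (M1 * M2) => x Ox; rewrite normrM ler_pM ?b1 ?b2.
Qed.

Lemma bmeasZ c h : bmeas h -> bmeas (fun x => c * h x).
Proof. by move=> bh; apply: bmeasM => //; exact: bmeas_cst. Qed.

Lemma bmeasN h : bmeas h -> bmeas (fun x => - h x).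
Proof.
by move=> /(bmeasZ (-1)); congr bmeas; apply/funext => x; rewrite mulN1r.
Qed.

Lemma bmeasB h1 h2 : bmeas h1 -> bmeas h2 -> bmeas (fun x => h1 x - h2 x).
Proof. by move=> b1 b2; apply: bmeasD => //; exact: bmeasN. Qed.

Lemma bmeas_norm h : bmeas h -> bmeas (fun x => `|h x|).
Proof.
move=> [m [M b]]; split; first exact: measurableT_comp.
by exists M => x Ox; rewrite normr_id b.
Qed.

Lemma bmeas_sum n (h : 'I_n -> pt -> R) : (forall i, bmeas (h i)) ->
  bmeas (fun x => \sum_(i < n) h i x).
Proof.
move=> bh; elim: n h bh => [|n IH] h bh.
  by under eq_fun do rewrite big_ord0; exact: bmeas_cst.
by under eq_fun do rewrite big_ord_recl; apply: bmeasD => //; exact: IH.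
Qed.

Lemma bmeas_p2 k : bmeas (p2 k).
Proof.
split; first exact: measurable_p2.
have [M hM] := tri_bounded; eexists => x Ox.
by have [x1 x2] := hM x (subset_closure Ox); exact: (p2_bounded _ x1 x2).
Qed.

(** What remains of both finite element spaces once continuity is forgotten; it is enough for
    differentiating and integrating. *)
Definition p2_pieces f := forall t, t \in Th -> exists k, forall x, tri_set t x -> f x = p2 k x.

Lemma Pk_fe_pieces b f : Pk_fe b Omega Th f -> p2_pieces f.
Proof.
case: b => -[h _ _] t /h; first by move=> /P2_onP.
move=> [c0 [c1 [c2 e]]]; exists (fun i => nth 0 [:: c0; c1; c2] i) => x /e ->.
by rewrite /p2 /=; ring.
Qed.

Lemma bmeas_pieces f : p2_pieces f -> bmeas f.
Proof.
move=> pf; split.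
  have [||_ m] := @piecewise_measurable _ Th (fun t => tri_set t) f.
  - by move=> t /tri_nondeg; exact: measurable_tri.
  - move=> t /pf [k e]; apply: (eq_measurable_fun (p2 k)); last exact: measurable_p2.
    by move=> x; rewrite inE => /e ->.
  apply: measurable_funS m => //; last by move=> x /tri_Omega_cover.
  by have [] := @piecewise_measurable _ Th (fun t => tri_set t) (fun=> 0 : R)
    (fun t tT => measurable_tri (tri_nondeg tT)) (fun _ _ => measurable_cst _).
have [t tTh|M hM] := @piecewise_bounded _ Th (fun t => tri_set t) f; last first.
  by exists M => x /tri_Omega_cover; exact: hM.
have [k e] := pf t tTh; have [M hM] := tri_set_bounded t.
by eexists => x tx; have [x1 x2] := hM x tx; rewrite e//; exact: (p2_bounded _ x1 x2).
Qed.

Lemma bmeas_pd j f : p2_pieces f -> bmeas (pd Th j f).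
Proof.
move=> pf.
have pdk t : t \in Th -> exists k, forall x, otri_set t x -> pd Th j f x = p2 k x.
  move=> tTh; have [k e] := pf t tTh; have [k' ek'] := dp2_p2 j k.
  exists k' => x tx; rewrite -ek'; apply: (pd_p2 _ tTh (tri_nondeg tTh)) => //.
pose E := [set x : pt | exists2 t, t \in Th & otri_set t x].
split.
  have [||mE mf] := @piecewise_measurable _ Th (fun t => otri_set t) (pd Th j f).
  - by move=> t /tri_nondeg; exact: measurable_otri.
  - move=> t /pdk [k e]; apply: (eq_measurable_fun (p2 k)); last exact: measurable_p2.
    by move=> x; rewrite inE => /e ->.
  (* The plane is split into the open cells, where the derivative is polynomial piece by piece, and
     their complement, where [pd] is 0 by convention. *)
  apply: measurable_funTS; rewrite -(setUv E).
  apply/measurable_funU => //; first exact: measurableC.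
  split; first exact: mf.
  apply: (eq_measurable_fun (cst (0 : R))); last exact: measurable_cst.
  by move=> x; rewrite inE => /(@pd_out _ Th j f) ->.
have [t tTh|M hM] := @piecewise_bounded _ Th (fun t => otri_set t) (pd Th j f); last first.
  exists (Num.max M 0) => x _.
  have [Ex|nEx] := pselect (E x); first by rewrite le_max hM.
  by rewrite pd_out// normr0 le_max lexx orbT.
have [k e] := pdk t tTh; have [M hM] := tri_set_bounded t.
eexists => x tx; have [x1 x2] := hM x (otri_sub_tri tx); rewrite e//; exact: (p2_bounded _ x1 x2).
Qed.

(** Holds at every point and not merely almost everywhere, because both sides are 0 off the open
    cells. *)
Lemma pd_linear j c f g x : p2_pieces f -> p2_pieces g ->
  pd Th j (fun y => c * f y + g y) x = c * pd Th j f x + pd Th j g x.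
Proof.
move=> pf pg.
have [[t tTh tx]|nE] := pselect (exists2 t, t \in Th & otri_set t x); last first.
  by rewrite !pd_out// mulr0 addr0.
have nd := tri_nondeg tTh.
have [kf ef] := pf t tTh; have [kg eg] := pg t tTh.
rewrite (pd_p2 j tTh nd ef tx) (pd_p2 j tTh nd eg tx) -dp2D.
by apply: (pd_p2 j tTh nd _ tx) => y ty; rewrite ef// eg// p2D.
Qed.

End domain.

(** The product is dominated by [|M| * (f ^+ 2 + 1)], and the constant is integrable because the
    measure of [D] is finite. *)
Lemma integrable_L2M d (T : measurableType d) (R : realType)
    (mu : {measure set T -> \bar R}) (D : set T) (f h : T -> R) (M : R) :
  measurable D -> (mu D < +oo)%E -> measurable_fun D f ->
  mu.-integrable D (fun x => (f x ^+ 2)%:E) -> measurable_fun D h ->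
  (forall x, D x -> `|h x| <= M) -> mu.-integrable D (fun x => (f x * h x)%:E).
Proof.
move=> mD finD mf If2 mh hM.
have I1 : mu.-integrable D (EFin \o (fun=> `|M|)).
  apply: measurable_bounded_integrable => //.
  by exists `|M|; split; [exact: num_real|move=> r Mr x _ /=; rewrite normr_id ltW].
have Idom := integrableD mD (integrableZl mD `|M| If2) I1.
apply: le_integrable Idom => //; first by apply/measurable_EFinP; apply: measurable_funM.
move=> x Dx /=; rewrite lee_fin normrM.
have M1 : 0 <= `|M| * f x ^+ 2 + `|M| by rewrite addr_ge0// mulr_ge0// sqr_ge0.
rewrite (ger0_norm M1).
have h1 : `|f x| * `|h x| <= `|f x| * `|M|.
  by rewrite ler_wpM2l// (le_trans (hM x Dx))// ler_norm.
have h2 : `|f x| <= f x ^+ 2 + 1.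
  by rewrite -[f x ^+ 2]real_normK ?num_real//; move: `|f x| => s; have := sqr_ge0 (s - 1); nra.
by rewrite (le_trans h1)// -[X in _ + X]mulr1 -mulrDr mulrC ler_wpM2l.
Qed.

(** * Integrals over the domain and what their vanishing implies *)

Section integrals.
Context {R : realType} (Omega : set (@pt R)) (Th : seq (@tri R)).
Hypothesis TO : triangulation Omega Th.
Local Notation pt := (@pt R).
Implicit Types (h f : pt -> R).
Local Notation I := (Rintegral leb2 Omega).

(* [tri_measurable], typed over the sigma-algebra that carries [leb2]. *)
Let mO : measurable (Omega : set (g_sigma_algebraType (R.-ocitv.-measurable) *
  g_sigma_algebraType (R.-ocitv.-measurable))) := tri_measurable TO.

Definition integ h := leb2.-integrable Omega (EFin \o h).

Lemma bmeas_integ h : bmeas Omega h -> integ h.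
Proof.
move=> [mh [M hM]]; apply: measurable_bounded_integrable => //.
- exact: (leb2_fin TO).
- by exists M; split; [exact: num_real|move=> r Mr x Ox /=; rewrite (le_trans (hM x Ox))// ltW].
Qed.

Lemma integ_lin c f h : integ f -> integ h -> integ (fun x => c * f x + h x).
Proof.
move=> If Ih; have := integrableD mO (integrableZl mO c If) Ih.
by apply: eq_integrable.
Qed.

(** The shape [c * f + h] matches [linear_on]; later, scaling alone is the case of a zero [h] and
    addition the case [c = 1]. *)
Lemma int_lin c f h : integ f -> integ h ->
  I (fun x => c * f x + h x) = c * I f + I h.
Proof.
move=> If Ih; rewrite RintegralD//; first by rewrite RintegralZl.
by have := integrableZl mO c If.
Qed.

Lemma int_le f h : integ f -> integ h -> (forall x, Omega x -> f x <= h x) ->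
  I f <= I h.
Proof. by move=> If Ih fh; exact: le_Rintegral. Qed.

Lemma eq_int f h : (forall x, Omega x -> f x = h x) -> I f = I h.
Proof. by move=> fh; apply: eq_Rintegral => x; rewrite inE; exact: fh. Qed.

Lemma int_norm f : integ f -> `|I f| <= I (fun x => `|f x|).
Proof. by move=> If; exact: le_normr_Rintegral. Qed.

Lemma int_cst0 : I (fun=> 0) = 0.
Proof. by rewrite (Rintegral_cst _ mO) mul0r. Qed.

Lemma integ_L2M f h : L2dom Omega f -> bmeas Omega h -> integ (fun x => f x * h x).
Proof.
move=> [mf If2] [mh [M hM]].
by apply: (@integrable_L2M _ _ _ leb2 Omega f h M) => //; exact: (leb2_fin TO).
Qed.

(* [h] stays above half its value on a box around [x], so its integral is positive. *)
Lemma int_eq0_continuous h x : bmeas Omega h -> (forall y, Omega y -> 0 <= h y) ->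
  I h = 0 -> Omega x -> {for x, continuous h} -> h x = 0.
Proof.
move=> bh h0 Ih0 Ox hc; apply/eqP; apply: contrapT => /negP hx.
have hx0 : 0 < h x by rewrite lt_neqAle eq_sym hx h0.
have d0 : 0 < h x / 2 by rewrite divr_gt0.
have nb : nbhs x [set y | Omega y /\ h x / 2 < h y].
  apply: filterI; first exact: open_nbhs_nbhs (conj (tri_open TO) Ox).
  apply: (hc [set r | h x / 2 < r]); apply: open_nbhs_nbhs; split; first exact: open_gt.
  by rewrite /=; lra.
have [e e0 eU] := (nbhs_box _ _).1 nb.
pose B := [set y : pt | `|x.1 - y.1| < e /\ `|x.2 - y.2| < e].
have mB : measurable B by exact: measurable_box.
have bB : bmeas Omega (fun y => \1_B y).
  split; first exact: measurable_funTS (measurable_indic _).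
  by exists 1 => y _; rewrite indicE; case: (_ \in _); rewrite ?normr1 ?normr0.
have : I (fun y => h x / 2 * \1_B y) <= I h.
  apply: int_le; [exact: bmeas_integ (bmeasZ _ bB)|exact: bmeas_integ|].
  move=> y Oy; rewrite indicE; case: (boolP (y \in B)) => [|_]; last by rewrite mulr0 h0.
  by rewrite inE mulr1 => -[y1 y2]; apply: ltW; have [] := eU y y1 y2.
rewrite RintegralZl//; last exact: bmeas_integ.
rewrite Ih0 leNgt mulr_gt0//.
have BO : B `&` Omega = B.
  by apply/seteqP; split=> [y []|y By] //; split=> //; have [] := eU y By.1 By.2.
rewrite /Rintegral integral_indic//.
rewrite BO.
have pos (v : \bar R) : v = (e *+ 2 * (e *+ 2))%:E -> 0 < fine v.
  by move=> -> /=; rewrite mulr_gt0// pmulrn_lgt0.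
have prod (u v : \bar R) :
    u = (e *+ 2)%:E -> v = (e *+ 2)%:E -> (u * v)%E = (e *+ 2 * (e *+ 2))%:E.
  by move=> -> ->.
apply: pos; have -> : B = (ball x.1 e : set R) `*` (ball x.2 e : set R) by [].
etransitivity.
  by apply: product_measure1E; apply: open_measurable; exact: ball_open.
by apply: prod; exact: lebesgue_measure_ball (ltW e0).
Qed.

(** Derivatives jump across edges, so continuity can only be had at interior points of cells;
    [int_eq0_continuous] asks for no more than that. *)
Lemma pd_continuous j f t x : p2_pieces Th f -> t \in Th -> otri_set t x ->
  {for x, continuous (pd Th j f)}.
Proof.
move=> pf tTh tx; have [k fk] := pf t tTh; have [k' e] := dp2_p2 j k.
have nd := tri_nondeg TO tTh.
have nfk : \forall y \near x, pd Th j f y = p2 k' y.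
  have := open_nbhs_nbhs (conj (otri_open nd) tx).
  by apply: filterS => y ty; rewrite -e; apply: (pd_p2 j tTh nd).
suff : pd Th j f y @[y --> x] --> p2 k' x by rewrite -(nbhs_singleton nfk).
apply: cvg_trans (@continuous_p2 _ k' x); apply: near_eq_cvg.
by apply: filterS nfk => y ->.
Qed.

(** The cells cover the closure of the domain, so the barycentre of [t] lies in that closure, and
    the open cell is a neighbourhood of it. *)
Lemma otri_meets t : t \in Th -> exists2 x, Omega x & otri_set t x.
Proof.
move=> tTh.
pose z := comb3 (tv1 t) (tv2 t) (tv3 t) 3^-1 3^-1 3^-1.
have tz : otri_set t z.
  by exists 3^-1, 3^-1, 3^-1; split=> //; rewrite ?invr_gt0//; field.
have cz : closure Omega z by apply/(tri_cover TO); exists t => //; exact: otri_sub_tri.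
have [x [Ox tx]] := cz _ (open_nbhs_nbhs (conj (otri_open (tri_nondeg TO tTh)) tz)).
by exists x.
Qed.

Lemma fe_continuous b f x : Pk_fe b Omega Th f -> Omega x -> {for x, continuous f}.
Proof.
move=> [_ cf _] Ox.
have oO := tri_open TO.
have : {within Omega, continuous f}.
  by apply: continuous_subspaceW cf; exact: subset_closure.
by rewrite continuous_open_subspace// => /(_ x); apply; rewrite inE.
Qed.

(** Continuity up to the boundary extends the zero to the closure, and the normalisation gives it
    outside; uniqueness can thus be an equality of functions. *)
Lemma fe_eq0 b f : Pk_fe b Omega Th f -> (forall x, Omega x -> f x = 0) -> f = 0.
Proof.
move=> ff f0; apply/funext => x.
have [cx|ncx] := pselect (closure Omega x); last by case: ff => _ _ ->.
apply/eqP; apply: contrapT => /negP fx.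
have [_ cf _] := ff.
have oN : nbhs (f x) [set r | r != 0] by apply: open_nbhs_nbhs; split; [exact: open_neq|].
have : nbhs_subspace (x : subspace (closure Omega)) (f @^-1` [set r | r != 0]) := cf x _ oN.
rewrite -nbhs_subspace_in// => h.
have [y [Oy yn]] := cx _ h.
by have := yn (subset_closure Oy); rewrite /= f0// eqxx.
Qed.

(** The values at [x] and at two points shifted along the axes by half the width of a box determine
    the three coefficients. *)
Lemma affine_eq0 (U : set pt) (a b c : R) x : open U -> U x ->
  (forall y, U y -> a + b * y.1 + c * y.2 = 0) -> [/\ a = 0, b = 0 & c = 0].
Proof.
move=> oU Ux h; have [e e0 eU] := open_box oU Ux.
have e2 : `|e / 2| < e by rewrite ger0_norm ?divr_ge0 ?ltW//; lra.
have h0 := h _ Ux.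
have U1 : U (x.1 + e / 2, x.2).
  by apply: eU; rewrite /= ?subrr ?normr0// opprD addNKr normrN.
have U2 : U (x.1, x.2 + e / 2).
  by apply: eU; rewrite /= ?subrr ?normr0// opprD addNKr normrN.
have h1 := h _ U1; have h2 := h _ U2; rewrite /= in h1 h2.
have b0 : b = 0.
  have : b * (e / 2) = 0 by rewrite -[RHS](subrr 0) -{1}h1 -h0; ring.
  by move/eqP; rewrite mulf_eq0 (gt_eqF (divr_gt0 e0 _))// orbF => /eqP.
have c0 : c = 0.
  have : c * (e / 2) = 0 by rewrite -[RHS](subrr 0) -{1}h2 -h0; ring.
  by move/eqP; rewrite mulf_eq0 (gt_eqF (divr_gt0 e0 _))// orbF => /eqP.
by split=> //; rewrite -h0 b0 c0; ring.
Qed.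

End integrals.

(** If the end values differed, the intermediate value theorem would attain all the equally spaced
    values [v k] between them. Those with [k] from 0 to [size s] are distinct and already one too
    many for [s]. *)
Lemma finite_valued_continuous (R : realType) (g : R -> R) (s : seq R) (a b : R) :
  a <= b -> {within `[a, b], continuous g} ->
  (forall x, x \in `[a, b] -> g x \in s) -> g a = g b.
Proof.
move=> ab gc gs; apply/eqP; apply: contrapT => /negP gab.
pose v (k : nat) := g a + (g b - g a) * (k%:R / (size s).+1%:R).
have vs k : (k <= (size s).+1)%N -> v k \in s.
  move=> ks; have k01 : 0 <= (k%:R / (size s).+1%:R : R) <= 1.
    by apply/andP; split; [exact: divr_ge0|rewrite ler_pdivrMr// mul1r ler_nat].
  have [|x xab <-] := @IVT _ g a b (v k) ab gc; last exact: gs.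
  rewrite /v; move: (k%:R / _) k01 => r /andP[r0 r1].
  rewrite ge_min le_max; have [h|h] := leP (g a) (g b).
    have : 0 <= (g b - g a) * r by rewrite mulr_ge0// subr_ge0.
    have : (g b - g a) * r <= g b - g a by rewrite ler_piMr// subr_ge0.
    by move=> h1 h2; apply/andP; split; apply/orP; [left|right]; lra.
  have : (g b - g a) * r <= 0 by rewrite mulr_le0_ge0// subr_le0 ltW.
  have : g b - g a <= (g b - g a) * r by rewrite ler_niMr// subr_le0 ltW.
  by move=> h1 h2; apply/andP; split; apply/orP; [right|left]; lra.
have vi : injective v.
  move=> i j /addrI /(mulfI _) h.
  have /h : g b - g a != 0 by rewrite subr_eq0 eq_sym.
  by move=> /(mulIf _) h2; apply/eqP; rewrite -(eqr_nat R) h2// invr_eq0.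
have := @uniq_leq_size _ [seq v k | k <- iota 0 (size s).+1] s.
rewrite map_inj_uniq// iota_uniq size_map size_iota => /(_ isT).
rewrite ltnn; apply: contraPP => _ /(_ _) h.
suff : false by [].
by apply: h => x /mapP[k]; rewrite mem_iota add0n => /andP[_ /ltnW ks] ->; exact: vs.
Qed.

Local Notation i1 := (lift ord0 ord0 : 'I_2).

(** * Discrete Korn argument *)

Section korn.
Context {R : realType} (Omega : set (@pt R)) (Th : seq (@tri R)).
Hypothesis TO : triangulation Omega Th.
Local Notation pt := (@pt R).
Variable u : @vfield R.
Hypotheses (u1 : Pk_fe true Omega Th u.1) (u2 : Pk_fe true Omega Th u.2).
Hypothesis eps0 : forall x t, Omega x -> t \in Th -> otri_set t x -> eps Th u x = 0.

(** Each strain entry is affine on the cell and vanishes on a nonempty open part of it. The nine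
    resulting relations between the twelve coefficients leave only the two constants and [b = l 1]
    free. *)
Lemma eps_eq0_rigid_cell t : t \in Th -> exists a1 a2 b : R,
  forall x, tri_set t x -> u.1 x = a1 - b * x.2 /\ u.2 x = a2 + b * x.1.
Proof.
move=> tTh.
have [k ek] := Pk_fe_pieces u1 tTh; have [l el] := Pk_fe_pieces u2 tTh.
have nd := tri_nondeg TO tTh.
pose U := Omega `&` otri_set t.
have oU : open U by apply: openI; [exact: (tri_open TO)|exact: otri_open].
have [x0 Ox0 tx0] := otri_meets TO tTh.
have Ux0 : U x0 by [].
have e i j x : U x -> dp2 j (if i == ord0 then k else l) x
    + dp2 i (if j == ord0 then k else l) x = 0.
  move=> [Ox tx]; have /matrixP /(_ i j) := eps0 Ox tTh tx.
  rewrite !mxE => /eqP; rewrite mulf_eq0 invr_eq0 (negbTE (_ : 2 != 0)) ?pnatr_eq0//= => /eqP <-.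
  rewrite /vcomp; congr (_ + _); apply/esym.
    by case: (i == ord0); [exact: (pd_p2 _ tTh nd ek)|exact: (pd_p2 _ tTh nd el)].
  by case: (j == ord0); [exact: (pd_p2 _ tTh nd ek)|exact: (pd_p2 _ tTh nd el)].
have [e1 e3 e4] : [/\ k 1%N + k 1%N = 0, 4 * k 3%N = 0 & 2 * k 4%N = 0].
  apply: (affine_eq0 oU Ux0) => y /(e ord0 ord0) <-; rewrite /dp2 /=; ring.
have [f2 f4 f5] : [/\ l 2%N + l 2%N = 0, 2 * l 4%N = 0 & 4 * l 5%N = 0].
  apply: (affine_eq0 oU Ux0) => y /(e i1 i1) <-; rewrite /dp2 /=; ring.
have [g1 g2 g3] : [/\ k 2%N + l 1%N = 0, k 4%N + 2 * l 3%N = 0 & 2 * k 5%N + l 4%N = 0].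
  apply: (affine_eq0 oU Ux0) => y /(e ord0 i1) <-; rewrite /dp2 /=; ring.
exists (k 0%N), (l 0%N), (l 1%N) => x tx; rewrite ek// el// /p2.
have -> : k 1%N = 0 by lra.
have -> : k 3%N = 0 by lra.
have -> : k 4%N = 0 by lra.
have -> : k 5%N = 0 by lra.
have -> : k 2%N = - l 1%N by lra.
have -> : l 2%N = 0 by lra.
have -> : l 3%N = 0 by lra.
have -> : l 4%N = 0 by lra.
have -> : l 5%N = 0 by lra.
by split; ring.
Qed.

(* On a segment the quantity [(u z - u x) . (y - x)] is constant on every cell,
   so it takes finitely many values; being continuous it is constant. No
   adjacency between the cells is needed. *)
Lemma eps_eq0_isometric x y : Omega x -> Omega y ->
  (u.1 y - u.1 x) * (y.1 - x.1) + (u.2 y - u.2 x) * (y.2 - x.2) = 0.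
Proof.
move=> Ox Oy.
pose z s := lin2 s x y.
have Oz s : s \in `[0, 1] -> Omega (z s).
  by rewrite in_itv/= => /andP[s0 s1]; case: TO => _ cvx _ _ _; exact: cvx.
pose g s := (u.1 (z s) - u.1 x) * (y.1 - x.1) + (u.2 (z s) - u.2 x) * (y.2 - x.2).
have z0 : z 0 = x by rewrite /z /lin2 [RHS]surjective_pairing; congr (_, _); ring.
have z1 : z 1 = y by rewrite /z /lin2 [RHS]surjective_pairing; congr (_, _); ring.
have zc : continuous z.
  move=> s.
  have lc (p q : R) : (1 - r) * p + r * q @[r --> s] --> (1 - s) * p + s * q.
    by do ![exact: cvg_id | exact: cvg_cst | apply: cvgD | apply: cvgN | apply: cvgM].
  exact: (cvg_pair (lc x.1 y.1) (lc x.2 y.2)).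
have gc : {within `[0, 1], continuous g}.
  apply: continuous_in_subspaceT => s; rewrite inE => /Oz Ozs.
  have c1 : u.1 (z r) @[r --> s] --> u.1 (z s).
    exact: (continuous_comp (zc s) (fe_continuous TO u1 Ozs)).
  have c2 : u.2 (z r) @[r --> s] --> u.2 (z s).
    exact: (continuous_comp (zc s) (fe_continuous TO u2 Ozs)).
  by do ![exact: c1 | exact: c2 | exact: cvg_cst | apply: cvgD | apply: cvgN | apply: cvgM].
have /choice [val valE] : forall t, exists v, t \in Th -> forall s, tri_set t (z s) -> g s = v.
  move=> t; have [tTh|] := boolP (t \in Th); last by exists 0.
  have [a1 [a2 [b h]]] := eps_eq0_rigid_cell tTh.
  eexists => _ s /h [h1 h2]; rewrite /g h1 h2 /z /lin2 /=.
  (* The parameter drops out: moving along the segment changes a rigid motion by a multiple of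
     [y - x] turned by a right angle, which is orthogonal to [y - x]. *)
  have -> : (a1 - b * ((1 - s) * x.2 + s * y.2) - u.1 x) * (y.1 - x.1)
    + (a2 + b * ((1 - s) * x.1 + s * y.1) - u.2 x) * (y.2 - x.2) =
    (a1 - b * x.2 - u.1 x) * (y.1 - x.1) + (a2 + b * x.1 - u.2 x) * (y.2 - x.2) by ring.
  by [].
have := @finite_valued_continuous R g [seq val t | t <- Th] 0 1 ler01 gc.
rewrite /g z0 z1 !subrr !mul0r addr0 => -> // s /Oz /(tri_Omega_cover TO) [t tTh tz].
by rewrite -/(g s) (valE t tTh s tz); exact: map_f.
Qed.

(** The motion of one cell serves for the whole domain. For any [y], the defect [w] of [u] at [y]
    satisfies [w . (y - z) = 0] for every [z] in an open part of that cell, since both [u] and the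
    motion satisfy the isometry identity; an affine function of [z] vanishing on an open set has
    zero coefficients. *)
Lemma eps_eq0_rigid : exists a1 a2 b : R,
  forall x, Omega x -> u.1 x = a1 - b * x.2 /\ u.2 x = a2 + b * x.1.
Proof.
have [x0 Ox0] := tri_neq0 TO.
have [t tTh _] := tri_Omega_cover TO Ox0.
have [a1 [a2 [b h]]] := eps_eq0_rigid_cell tTh.
exists a1, a2, b => y Oy.
have [x Ox tx] := otri_meets TO tTh.
pose U := Omega `&` otri_set t.
have oU : open U by apply: openI; [exact: (tri_open TO)|exact: (otri_open (tri_nondeg TO tTh))].
have Ux : U x by [].
pose w1 := u.1 y - (a1 - b * y.2); pose w2 := u.2 y - (a2 + b * y.1).
have [_ w10 w20] : [/\ w1 * y.1 + w2 * y.2 = 0, - w1 = 0 & - w2 = 0].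
  apply: (affine_eq0 oU Ux) => z [Oz tz].
  rewrite -[RHS](eps_eq0_isometric Oz Oy).
  have [-> ->] := h _ (otri_sub_tri tz).
  by rewrite /w1 /w2; ring.
by split; apply/eqP; rewrite -subr_eq0 -oppr_eq0; apply/eqP.
Qed.

End korn.

Section rigid_orthogonality.
Context {R : realType} (Omega : set (@pt R)) (Th : seq (@tri R)).
Hypothesis TO : triangulation Omega Th.

(** On the domain such a field is a rigid motion, hence one of the fields it is orthogonal to, so
    its L2 norm is zero. *)
Lemma Vh_eps_eq0 (u : @vfield R) : Vh Omega Th u ->
  (forall x t, Omega x -> t \in Th -> otri_set t x -> eps Th u x = 0) -> u = 0.
Proof.
move=> [[u1 u2] orth] e0.
have [a1 [a2 [b h]]] := eps_eq0_rigid TO u1 u2 e0.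
pose k1 := fun i => nth 0 [:: a1; 0; - b] i.
pose k2 := fun i => nth 0 [:: a2; b] i.
have uk x : Omega x -> u.1 x = p2 k1 x /\ u.2 x = p2 k2 x.
  by move=> /h [-> ->]; rewrite /p2 /k1 /k2 /=; split; ring.
pose q x := p2 k1 x * p2 k1 x + p2 k2 x * p2 k2 x.
have bq : bmeas Omega q by apply: bmeasD; apply: bmeasM; exact: (bmeas_p2 TO).
have q0 : Rintegral leb2 Omega q = 0.
  rewrite -(orth a1 a2 b); apply: eq_int => x Ox.
  by have [-> ->] := uk x Ox; rewrite /q /rigid /p2 /k1 /k2 /=; ring.
have qx x : Omega x -> q x = 0.
  move=> Ox; apply: (int_eq0_continuous TO bq _ q0 Ox).
    by move=> y _; rewrite /q -!expr2 addr_ge0// sqr_ge0.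
  have c1 := @continuous_p2 _ k1 x; have c2 := @continuous_p2 _ k2 x.
  have c : q y @[y --> x] --> q x.
    by rewrite /q; do ![exact: c1 | exact: c2 | apply: cvgD | apply: cvgM].
  exact: c.
have ux x : Omega x -> u.1 x = 0 /\ u.2 x = 0.
  move=> Ox; have := qx x Ox; have [-> ->] := uk x Ox.
  rewrite /q -!expr2 => /eqP; rewrite paddr_eq0 ?sqr_ge0// !sqrf_eq0.
  by move=> /andP[/eqP -> /eqP ->].
rewrite [u]surjective_pairing; congr (_, _).
  by apply: (fe_eq0 u1) => x /ux[].
by apply: (fe_eq0 u2) => x /ux[].
Qed.

End rigid_orthogonality.

(** * Coefficient vectors of finite element functions *)

Section coefficients.
Context {R : realType} (Omega : set (@pt R)) (Th : seq (@tri R)).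
Hypothesis TO : triangulation Omega Th.
Local Notation pt := (@pt R).

Lemma p2_eq0 (k : nat -> R) x : (forall j, (j < 6)%N -> k j = 0) -> p2 k x = 0.
Proof. by move=> k0; rewrite /p2 !k0//; ring. Qed.

Lemma p2_sum d (y : 'I_d -> R) (k : 'I_d -> nat -> R) x :
  \sum_(i < d) y i * p2 (k i) x = p2 (fun j => \sum_(i < d) y i * k i j) x.
Proof.
elim: d y k => [|d IH] y k.
  by rewrite big_ord0 p2_eq0// => j _; rewrite big_ord0.
rewrite big_ord_recl IH -p2D; congr (p2 _ x); apply/funext => j.
by rewrite [RHS]big_ord_recl.
Qed.

(** Coefficients are picked cell by cell by choice. A combination of functions has, on each cell,
    the combined coefficients, so it vanishes there as soon as these do. *)
Lemma fe_coef b : exists coef : (pt -> R) -> 'rV[R]_(size Th * 6),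
  coef_independent (Pk_fe b Omega Th) coef.
Proof.
have /choice [K KE] : forall ft : (pt -> R) * @tri R, exists k,
    Pk_fe b Omega Th ft.1 -> ft.2 \in Th -> forall x, tri_set ft.2 x -> ft.1 x = p2 k x.
  move=> [f t] /=; have [[ff tTh]|n] := pselect (Pk_fe b Omega Th f /\ t \in Th).
    by have [k ek] := Pk_fe_pieces ff tTh; exists k.
  by exists (fun=> 0) => ff tTh; case: n.
(* Six consecutive entries per cell: entry [6 * i + j] is the j-th coefficient on the i-th cell. *)
exists (fun f => \row_q K (f, nth tri0 Th (q %/ 6)) (q %% 6)%N) => d e y Pe e0.
apply/funext => x; rewrite fct_sumE /=.
have [cx|ncx] := pselect (closure Omega x); last first.
  by apply: big1 => i _; case: (Pe i) => _ _ /(_ x ncx) ex; rewrite -[LHS]/(y i * e i x) ex mulr0.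
have [t tTh tx] := (tri_cover TO x).1 cx.
have -> : \sum_(i < d) (y i *: e i) x = \sum_(i < d) y i * p2 (K (e i, t)) x.
  by apply: eq_bigr => i _; congr (y i * _); exact: (KE (e i, t) (Pe i) tTh x tx).
rewrite p2_sum p2_eq0// => j j6.
have iTh := tTh; rewrite -index_mem in iTh.
have q_lt : (index t Th * 6 + j < size Th * 6)%N.
  by rewrite (@leq_trans ((index t Th).+1 * 6)) ?leq_pmul2r// mulSn addnC ltn_add2r.
move/rowP: e0 => /(_ (Ordinal q_lt)); rewrite summxE mxE => e0.
rewrite -[RHS]e0; apply: eq_bigr => i _.
by rewrite !mxE /= divnMDl// divn_small// addn0 nth_index// modnMDl modn_small.
Qed.

End coefficients.

(** * Boundary terms and finite element spaces *)

Section boundary.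
Context {R : realType} (Omega : set (@pt R)) (Th : seq (@tri R)).
Hypothesis TO : triangulation Omega Th.
Local Notation pt := (@pt R).

Lemma edge_sub_tri t e s : e \in edges t -> 0 <= s -> s <= 1 ->
  tri_set t (lin2 s e.1 e.2 : pt).
Proof.
move=> et s0 s1; have s1' : 0 <= 1 - s by rewrite subr_ge0.
move: et; rewrite !inE => /or3P[] /eqP -> /=.
- by exists (1 - s), s, 0; split=> //; [ring|rewrite /comb3 /lin2; congr (_, _); ring].
- by exists 0, (1 - s), s; split=> //; [ring|rewrite /comb3 /lin2; congr (_, _); ring].
- by exists s, 0, (1 - s); split=> //; [ring|rewrite /comb3 /lin2; congr (_, _); ring].
Qed.

(** Along an edge of the i-th cell [h] agrees with the polynomial of that cell and is therefore
    bounded, so square integrability of [f] suffices. *)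
Lemma integrable_edge (f h : pt -> R) i e : L2bnd Th f -> p2_pieces Th h ->
  (i < size Th)%N -> e \in edges (nth tri0 Th i) -> bedge Th i e ->
  (@lebesgue_measure R).-integrable I01
    (EFin \o (fun s => f (lin2 s e.1 e.2) * h (lin2 s e.1 e.2))).
Proof.
move=> Lf ph iT ei bi; have [mf If2] := Lf i e iT ei bi.
have tTh := mem_nth tri0 iT; have [k ek] := ph _ tTh.
have [M hM] := tri_set_bounded (nth tri0 Th i).
have hk s : I01 s -> h (lin2 s e.1 e.2) = p2 k (lin2 s e.1 e.2).
  by rewrite /I01/= in_itv/= => /andP[s0 s1]; apply: ek; exact: edge_sub_tri.
have mI : measurable (I01 : set R) by exact: measurable_itv.
eapply integrable_L2M => //.
- have fin (v : \bar R) : v = 1%:E -> (v < +oo)%E by move=> ->; rewrite ltry.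
  apply: fin; etransitivity; first exact: (lebesgue_measure_itv `[(0:R), 1]).
  by rewrite /= lte_fin ltr01 oppr0 adde0.
- apply: (eq_measurable_fun (fun s => p2 k (lin2 s e.1 e.2))).
    by move=> s; rewrite inE => /hk ->.
  apply: measurable_funTS; rewrite /p2 /lin2 /=.
  by do ![exact: measurable_id | exact: measurable_cst | apply: measurable_funD |
    apply: measurable_funB | apply: measurable_funM | apply: measurable_funX].
- move=> s Is; rewrite hk//; move: Is; rewrite /I01/= in_itv/= => /andP[s0 s1].
  have [x1 x2] := hM _ (edge_sub_tri ei s0 s1); exact: (p2_bounded _ x1 x2).
Qed.

Lemma bip_lin (f h1 h2 : pt -> R) c : L2bnd Th f -> p2_pieces Th h1 -> p2_pieces Th h2 ->
  bip Th f (fun x => c * h1 x + h2 x) = c * bip Th f h1 + bip Th f h2.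
Proof.
move=> Lf p1 p2'; rewrite /bip mulr_sumr -big_split; apply: eq_bigr => i _.
rewrite mulr_sumr -big_split /= big_seq_cond [RHS]big_seq_cond.
apply: eq_bigr => e /andP[ei /asboolP bi].
rewrite /eint mulrCA -mulrDr; congr (_ * _).
have I1 := integrable_edge Lf p1 (ltn_ord i) ei bi.
have I2 := integrable_edge Lf p2' (ltn_ord i) ei bi.
have mI : measurable (I01 : set (g_sigma_algebraType (R.-ocitv.-measurable))).
  exact: (measurable_itv `[(0:R), 1]).
rewrite -(RintegralZl _ mI I1)// -RintegralD//; last first.
  by have := integrableZl mI c I1.
by apply: eq_Rintegral => s _; rewrite mulrDr mulrCA.
Qed.

End boundary.

Section spaces.
Context {R : realType} (Omega : set (@pt R)) (Th : seq (@tri R)).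
Hypothesis TO : triangulation Omega Th.
Local Notation pt := (@pt R).
Implicit Types u v : @vfield R.

Definition vpieces v := p2_pieces Th v.1 /\ p2_pieces Th v.2.

Lemma p2_pieces_lin c f g : p2_pieces Th f -> p2_pieces Th g ->
  p2_pieces Th (fun x => c * f x + g x).
Proof.
move=> pf pg t tTh; have [kf ef] := pf t tTh; have [kg eg] := pg t tTh.
by exists (fun i => c * kf i + kg i) => x tx; rewrite p2D ef// eg.
Qed.

Lemma Pk_fe_subspace b : subspace_pred (Pk_fe b Omega Th).
Proof.
split.
  split=> [t _||//]; last by move=> x; exact: cvg_cst.
  case: b; first by exists 0, 0, 0, 0, 0, 0 => x _; rewrite !mul0r !addr0.
  by exists 0, 0, 0 => x _; rewrite !mul0r !addr0.
move=> c f g [pf cf zf] [pg cg zg]; split.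
- move=> t tTh; move: (pf t tTh) (pg t tTh); case: b {pf pg}.
    move=> /P2_onP[k ek] /P2_onP[l el]; apply/P2_onP.
    by exists (fun i => c * k i + l i) => x tx; rewrite p2D -ek// -el.
  move=> [a0 [a1 [a2 ea]]] [b0 [b1 [b2 eb]]].
  exists (c * a0 + b0), (c * a1 + b1), (c * a2 + b2) => x tx.
  by rewrite -[LHS]/(c * f x + g x) ea// eb//; ring.
- move=> x; apply: cvgD; last exact: cg.
  by apply: cvgM; [exact: cvg_cst|exact: cf].
- by move=> x nx; rewrite -[LHS]/(c * f x + g x) zf// zg// mulr0 addr0.
Qed.

Lemma Vh_pieces v : Vh Omega Th v -> vpieces v.
Proof. by move=> [[v1 v2] _]; split; apply: Pk_fe_pieces; eauto. Qed.

Lemma Vh_subspace : subspace_pred (Vh Omega Th).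
Proof.
have [P0 PL] := Pk_fe_subspace true.
split.
  split; first by split.
  move=> a1 a2 b; rewrite /ipv -[RHS](int_cst0 TO); apply: eq_int => x _.
  by rewrite /= !mul0r addr0.
move=> c v w Vv Vw; have [pv1 pv2] := Vh_pieces Vv; have [pw1 pw2] := Vh_pieces Vw.
case: Vv Vw => -[v1 v2] ov [[w1 w2] ow]; split; first by split; exact: PL.
move=> a1 a2 b.
have br1 : bmeas Omega (rigid a1 a2 b).1.
  by apply: bmeasB; [exact: bmeas_cst|apply: bmeasZ];
    have := bmeas_p2 TO (fun i => nth 0 [:: 0; 0; 1] i);
    congr bmeas; apply/funext => x; rewrite /p2 /=; ring.
have br2 : bmeas Omega (rigid a1 a2 b).2.
  by apply: bmeasD; [exact: bmeas_cst|apply: bmeasZ];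
    have := bmeas_p2 TO (fun i => nth 0 [:: 0; 1] i);
    congr bmeas; apply/funext => x; rewrite /p2 /=; ring.
have bi z : vpieces z ->
    integ Omega (fun x => z.1 x * (rigid a1 a2 b).1 x + z.2 x * (rigid a1 a2 b).2 x).
  move=> [z1 z2]; apply: (bmeas_integ TO).
  by apply: bmeasD; apply: bmeasM => //; exact: (bmeas_pieces TO).
have := int_lin TO c (bi v _) (bi w _).
rewrite -!/(ipv Omega _ _) ov ow mulr0 addr0 => <- //.
by apply: eq_int => x _; rewrite /= !fctE /GRing.scale/=; ring.
Qed.

End spaces.

(** * Strain, stress and permeability as bounded measurable fields *)

Section pointwise.
Context {R : realType} (Omega : set (@pt R)) (Th : seq (@tri R)).
Hypothesis TO : triangulation Omega Th.
Local Notation pt := (@pt R).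
Implicit Types (u v : @vfield R) (A B : pt -> 'M[R]_2).

Lemma ddot_ge0 (A : 'M[R]_2) : 0 <= ddot A A.
Proof. by apply: sumr_ge0 => i _; apply: sumr_ge0 => j _; rewrite -expr2 sqr_ge0. Qed.

Lemma ddot_eq0 (A : 'M[R]_2) : ddot A A = 0 -> A = 0.
Proof.
move=> /eqP; rewrite psumr_eq0 => [/allP h|i _]; last first.
  by apply: sumr_ge0 => j _; rewrite -expr2 sqr_ge0.
apply/matrixP => i j; have := h i (mem_index_enum i); rewrite /= psumr_eq0.
  by move=> /allP /(_ j (mem_index_enum j)) /=; rewrite mulf_eq0 orbb mxE => /eqP.
by move=> k _; rewrite -expr2 sqr_ge0.
Qed.

Lemma ddotC (A B : 'M[R]_2) : ddot A B = ddot B A.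
Proof. by apply: eq_bigr => i _; apply: eq_bigr => j _; rewrite mulrC. Qed.

Lemma ddot_linr (A B C : 'M[R]_2) c : ddot A (c *: B + C) = c * ddot A B + ddot A C.
Proof.
rewrite /ddot mulr_sumr -big_split; apply: eq_bigr => i _ /=.
by rewrite mulr_sumr -big_split; apply: eq_bigr => j _ /=; rewrite !mxE; ring.
Qed.

Lemma ddot_linl (A B C : 'M[R]_2) c : ddot (c *: B + C) A = c * ddot B A + ddot C A.
Proof. by rewrite ddotC ddot_linr ddotC [ddot A C]ddotC. Qed.

Lemma sym_eps u x : sym_mx (eps Th u x).
Proof. by apply/matrixP => i j; rewrite !mxE addrC. Qed.

Lemma eps_lin u v c x : vpieces Th u -> vpieces Th v ->
  eps Th (c *: u + v) x = c *: eps Th u x + eps Th v x.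
Proof.
move=> [u1 u2] [v1 v2]; apply/matrixP => i j; rewrite !mxE.
have h k l : pd Th k (vcomp (c *: u + v) l) x = c * pd Th k (vcomp u l) x + pd Th k (vcomp v l) x.
  by rewrite /vcomp; case: (l == ord0); exact: (pd_linear TO).
by rewrite !h; ring.
Qed.

Lemma divv_lin u v c x : vpieces Th u -> vpieces Th v ->
  divv Th (c *: u + v) x = c * divv Th u x + divv Th v x.
Proof.
move=> [u1 u2] [v1 v2]; rewrite /divv.
have -> := pd_linear TO ord0 c x u1 v1.
by have -> := pd_linear TO i1 c x u2 v2; ring.
Qed.

Lemma bmeas_divv u : vpieces Th u -> bmeas Omega (divv Th u).
Proof. by move=> [u1 u2]; apply: bmeasD; exact: (bmeas_pd TO). Qed.

Definition bmeas_mx m n (A : pt -> 'M[R]_(m, n)) :=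
  forall i j, bmeas Omega (fun x => A x i j).

Lemma bmeas_eps u : vpieces Th u -> bmeas_mx (eps Th u).
Proof.
move=> [u1 u2] i j; rewrite /eps; under eq_fun do rewrite mxE.
by apply: bmeasZ; apply: bmeasD; apply: (bmeas_pd TO); rewrite /vcomp; case: ifP.
Qed.

Lemma bmeas_grad f : p2_pieces Th f -> bmeas_mx (grad Th f).
Proof.
by move=> pf i j; rewrite /grad; under eq_fun do rewrite mxE; exact: (bmeas_pd TO).
Qed.

Lemma bmeas_mulmx m n p (A : pt -> 'M[R]_(m, n)) (B : pt -> 'M[R]_(n, p)) :
  bmeas_mx A -> bmeas_mx B -> bmeas_mx (fun x => A x *m B x).
Proof.
move=> bA bB i j; under eq_fun do rewrite mxE.
by apply: bmeas_sum => k; exact: bmeasM.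
Qed.

Lemma bmeas_mxtrace (A : pt -> 'M[R]_2) : bmeas_mx A -> bmeas Omega (fun x => \tr (A x)).
Proof. by move=> bA; apply: bmeas_sum => i. Qed.

Lemma bmeas_ddot A B : bmeas_mx A -> bmeas_mx B -> bmeas Omega (fun x => ddot (A x) (B x)).
Proof.
by move=> bA bB; apply: bmeas_sum => i; apply: bmeas_sum => j; exact: bmeasM.
Qed.

Lemma bmeas_vdot (A B : pt -> 'cV[R]_2) : bmeas_mx A -> bmeas_mx B ->
  bmeas Omega (fun x => vdot (A x) (B x)).
Proof. by move=> bA bB; apply: bmeas_sum => i; exact: bmeasM. Qed.

Lemma ord2E (i : 'I_2) : i = ord0 \/ i = i1.
Proof. by case: i => -[|[|//]] h; [left|right]; exact: val_inj. Qed.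

(** For symmetric [tau] it is a weighted sum of two squares. This places the argument of [Phi] in
    the half-line on which the constitutive bounds are assumed. *)
Lemma devm_ge0 (tau : 'M[R]_2) : sym_mx tau -> 0 <= devm tau.
Proof.
move=> /matrixP /(_ ord0 i1); rewrite mxE => s.
have -> : devm tau = 2^-1 * (tau ord0 ord0 - tau i1 i1) ^+ 2 + 2 * tau ord0 i1 ^+ 2.
  by rewrite /devm /mxtrace !big_ord_recl !big_ord0 !mxE !big_ord_recl !big_ord0 s; field.
by rewrite addr_ge0// mulr_ge0// sqr_ge0.
Qed.

(** Measurability comes from the continuity of the derivative of [Phi], and boundedness from its
    lying between 0 and [kappa / mu] on nonnegative arguments. *)
Lemma bmeas_Nop kappa mu lambda (Phi : R -> R) a1 A : 0 < mu -> 0 < a1 ->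
  (forall x, derivable (derive1 Phi) x 1) ->
  (forall rho, 0 <= rho -> a1 <= mu * derive1 Phi rho /\ mu * derive1 Phi rho < kappa) ->
  (forall x, sym_mx (A x)) -> bmeas_mx A ->
  bmeas_mx (fun x => Nop kappa mu lambda Phi (A x)).
Proof.
move=> mu0 a10 dPhi bPhi sA bA.
have bdev : bmeas Omega (fun x => devm (A x)).
  apply: bmeasB; first by apply: bmeas_mxtrace; exact: bmeas_mulmx.
  by apply: bmeasZ; rewrite /=; under eq_fun do rewrite expr2; apply: bmeasM; exact: bmeas_mxtrace.
have bP : bmeas Omega (fun x => derive1 Phi (devm (A x))).
  split.
    apply: (measurableT_comp (f := derive1 Phi)); last by case: bdev.
    apply: continuous_measurable_fun => y.
    by apply: differentiable_continuous; apply/derivable1_diffP.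
  exists (kappa / mu) => x _; have [h1 h2] := bPhi _ (devm_ge0 (sA x)).
  have P0 : 0 < derive1 Phi (devm (A x)) by rewrite -(pmulr_rgt0 _ mu0); exact: lt_le_trans h1.
  by rewrite gtr0_norm// ler_pdivlMr// mulrC ltW.
have bmu : bmeas Omega (fun x => mu_t mu Phi (devm (A x))) by exact: bmeasZ.
have bla : bmeas Omega (fun x => lam_t kappa mu Phi (devm (A x))).
  by apply: bmeasB; [exact: bmeas_cst|exact: bmeasZ].
have btr := bmeas_mxtrace bA.
move=> i j; rewrite /Nop /sigmaHM; under eq_fun do rewrite !mxE.
apply: bmeasB.
  apply: bmeasD; last exact: bmeasM.
  by apply: bmeasM; [exact: bmeasM|exact: bmeas_cst].
by apply: bmeasM; [exact: bmeasZ|exact: bmeas_cst].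
Qed.

(* The entries are recovered from the quadratic form at (1,0), (0,1) and (1,1). *)
Lemma bmeas_elliptic (K : pt -> 'M[R]_2) K1 K2 : 0 < K1 ->
  (forall x, Omega x -> (K x)^T = K x) ->
  (forall i j, measurable_fun Omega (fun x => K x i j)) ->
  (forall x (z : 'cV[R]_2), Omega x ->
     K1 * vdot z z <= vdot (K x *m z) z /\ vdot (K x *m z) z <= K2 * vdot z z) ->
  bmeas_mx K.
Proof.
move=> K10 sK mK eK i j; split=> //; exists K2 => x Ox.
have /matrixP /(_ ord0 i1) := sK x Ox; rewrite mxE => s.
have q (p r : R) : K1 * (p * p + r * r) <= K x ord0 ord0 * p * p
    + 2 * (K x ord0 i1 * p * r) + K x i1 i1 * r * r <= K2 * (p * p + r * r).
  have [h1 h2] := eK x (\col_k (if k == ord0 then p else r)) Ox.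
  move: h1 h2; rewrite /vdot !big_ord_recl !big_ord0 !mxE !big_ord_recl !big_ord0 !mxE /= s.
  by move=> h1 h2; apply/andP; split; lra.
have /andP[a1 a2] := q 1 0; have /andP[b1 b2] := q 0 1.
(* With positive diagonal entries, these two vectors bound the off-diagonal entry by [K2] from above
   and from below. *)
have /andP[c1 c2] := q 1 1; have /andP[d1 d2] := q 1 (-1).
rewrite ler_norml.
case: (ord2E i) => ->; case: (ord2E j) => ->; rewrite ?s; apply/andP; split; lra.
Qed.

End pointwise.

Section linear_on_closure.
Context {R : realType} {W W' : lmodType R}.

Lemma linear_on_add (P : W -> Prop) (l1 l2 : W -> R) :
  linear_on P l1 -> linear_on P l2 -> linear_on P (fun w => l1 w + l2 w).
Proof. by move=> h1 h2 c x y Px Py; rewrite h1// h2//; ring. Qed.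

Lemma linear_on_scale (P : W -> Prop) (l : W -> R) a :
  linear_on P l -> linear_on P (fun w => a * l w).
Proof. by move=> h c x y Px Py; rewrite h//; ring. Qed.

Lemma linear_on_opp (P : W -> Prop) (l : W -> R) :
  linear_on P l -> linear_on P (fun w => - l w).
Proof. by move=> h c x y Px Py; rewrite h//; ring. Qed.

Lemma linear_on_sub (P : W -> Prop) (l1 l2 : W -> R) :
  linear_on P l1 -> linear_on P l2 -> linear_on P (fun w => l1 w - l2 w).
Proof. by move=> h1 h2; apply: linear_on_add => //; exact: linear_on_opp. Qed.

Lemma linear_on_comp (P : W -> Prop) (P' : W' -> Prop) (h : W -> W') (l : W' -> R) :
  (forall x, P x -> P' (h x)) -> (forall c x y, h (c *: x + y) = c *: h x + h y) ->
  linear_on P' l -> linear_on P (fun w => l (h w)).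
Proof. by move=> hP hl ll c x y Px Py; rewrite hl ll//; exact: hP. Qed.

End linear_on_closure.

(** * Entrywise and Frobenius norms *)

Section matrix_norms.
Context {R : realType}.
Implicit Types A B C : 'M[R]_2.

(** The entrywise l1 norm, whose triangle inequality and measurability are immediate, unlike those
    of a norm defined by a square root. *)
Definition abs_sum A : R := \sum_(i < 2) \sum_(j < 2) `|A i j|.

Lemma abs_sum_ge0 A : 0 <= abs_sum A.
Proof. by apply: sumr_ge0 => i _; apply: sumr_ge0. Qed.

Lemma abs_sumD A B : abs_sum (A + B) <= abs_sum A + abs_sum B.
Proof.
rewrite /abs_sum -big_split; apply: ler_sum => i _; rewrite -big_split.
by apply: ler_sum => j _; rewrite mxE; exact: ler_normD.
Qed.

Lemma abs_sumZ c A : abs_sum (c *: A) = `|c| * abs_sum A.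
Proof.
rewrite /abs_sum mulr_sumr; apply: eq_bigr => i _; rewrite mulr_sumr.
by apply: eq_bigr => j _; rewrite mxE normrM.
Qed.

Lemma entry_le_frobenius A i j : `|A i j| <= Num.sqrt (ddot A A).
Proof.
rewrite -sqrtr_sqr ler_sqrt ?ddot_ge0// /ddot (bigD1 i)//= (bigD1 j)//= -expr2 -addrA lerDl.
rewrite addr_ge0//; first by apply: sumr_ge0 => k _; rewrite -expr2 sqr_ge0.
by apply: sumr_ge0 => k _; apply: sumr_ge0 => l _; rewrite -expr2 sqr_ge0.
Qed.

Lemma frobenius_le_abs_sum A : Num.sqrt (ddot A A) <= abs_sum A.
Proof.
rewrite -[leRHS]ger0_norm ?abs_sum_ge0// -sqrtr_sqr ler_sqrt ?sqr_ge0//.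
rewrite expr2 {1}/abs_sum mulr_suml; apply: ler_sum => i _; rewrite mulr_suml.
apply: ler_sum => j _; rewrite (le_trans (ler_norm _))// normrM ler_wpM2l//.
rewrite /abs_sum (bigD1 i)//= (bigD1 j)//= -addrA lerDl addr_ge0//.
  by apply: sumr_ge0 => k _.
by apply: sumr_ge0 => k _; apply: sumr_ge0 => l _.
Qed.

(** A weak Cauchy-Schwarz inequality: the Frobenius norm is kept only in the slot where
    [lipschitz_mx] is going to be applied. *)
Lemma ddot_le A B : `|ddot A B| <= Num.sqrt (ddot A A) * abs_sum B.
Proof.
rewrite (le_trans (ler_norm_sum _ _ _))// /abs_sum mulr_sumr ler_sum// => i _.
rewrite (le_trans (ler_norm_sum _ _ _))// mulr_sumr ler_sum// => j _.
by rewrite normrM ler_wpM2r// entry_le_frobenius.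
Qed.

End matrix_norms.

(* With B = 1 the cross terms cancel when the coupling is implicit; when it is
   explicit, a small B lets the diagonal absorb the one that remains. *)
Lemma coupling_coercive (R : realType) (k1 k2 k3 : R) (theta : bool) : 0 < k2 -> 0 < k3 ->
  exists B c : R, [/\ 0 < B, 0 < c & forall X Y Z, 0 <= X -> 0 <= Z ->
    (forall s, 0 <= X + 2 * s * Y + s ^+ 2 * Z) ->
    c * (X + Z) <= k3 * X - (if theta then k1 * Y else 0) + B * (k1 * Y + k2 * Z)].
Proof.
move=> k20 k30; case: theta.
  exists 1, (Num.min k2 k3); rewrite lt_min k20 k30; split=> // X Y Z X0 Z0 _.
  have h2 : Num.min k2 k3 * Z <= k2 * Z by rewrite ler_wpM2r// ge_min lexx.
  have h3 : Num.min k2 k3 * X <= k3 * X by rewrite ler_wpM2r// ge_min lexx orbT.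
  by lra.
(* Chosen so that [B * k1 ^+ 2 <= k2 * k3]; the added 1 keeps the denominator positive for every
   [k1]. *)
pose B := k2 * k3 / (k1 ^+ 2 + 1).
have d0 : 0 < k1 ^+ 2 + 1 by rewrite ltr_wpDl// sqr_ge0.
have B0 : 0 < B by rewrite divr_gt0// mulr_gt0.
have Bk : B * (k1 ^+ 2 + 1) = k2 * k3 by rewrite /B divfK// gt_eqF.
clearbody B.
have Bk1 : B * k1 ^+ 2 <= k2 * k3 by rewrite -Bk mulrDr mulr1 lerDl ltW.
exists B, (Num.min (k3 / 2) (B * k2 / 2)).
have k3h : 0 < k3 / 2 by rewrite divr_gt0.
have Bkh : 0 < B * k2 / 2 by rewrite divr_gt0// mulr_gt0.
rewrite lt_min k3h Bkh; split=> // X Y Z X0 Z0 h.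
set c := Num.min _ _.
have h1 : c * X <= k3 / 2 * X by rewrite ler_wpM2r// ge_min lexx.
have h2 : c * Z <= B * k2 / 2 * Z by rewrite ler_wpM2r// ge_min lexx orbT.
(* Young's inequality: this value of [s] reproduces the cross term [B * k1 * Y] exactly, and by the
   choice of [B] it uses at most half of each diagonal term. *)
have h3 : 0 <= k3 / 2 * (X + 2 * (B * k1 / k3) * Y + (B * k1 / k3) ^+ 2 * Z).
  by rewrite mulr_ge0// ltW.
have e3 : k3 / 2 * (X + 2 * (B * k1 / k3) * Y + (B * k1 / k3) ^+ 2 * Z) =
    k3 / 2 * X + B * k1 * Y + B * (B * k1 ^+ 2) / k3 / 2 * Z.
  by field; rewrite gt_eqF.
have h4 : B * (B * k1 ^+ 2) / k3 / 2 * Z <= B * k2 / 2 * Z.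
  rewrite ler_wpM2r// ler_pM2r ?invr_gt0// ler_pdivrMr// -mulrA ler_wpM2l// ltW//.
by lra.
Qed.

(** * Integral forms of the scheme and their definiteness *)

Section forms.
Context {R : realType} (Omega : set (@pt R)) (Th : seq (@tri R)).
Hypothesis TO : triangulation Omega Th.
Local Notation pt := (@pt R).
Local Notation I := (Rintegral leb2 Omega).
Implicit Types f h p q : pt -> R.

Lemma ip_linl c f h p : bmeas Omega f -> bmeas Omega h -> bmeas Omega p ->
  ip Omega (c *: f + h) p = c * ip Omega f p + ip Omega h p.
Proof.
move=> bf bh bp; rewrite /ip.
have i1 := bmeas_integ TO (bmeasM bf bp); have i2 := bmeas_integ TO (bmeasM bh bp).
rewrite -(int_lin TO c i1 i2).
by apply: eq_int => x _; rewrite -[(c *: f + h) x]/(c * f x + h x); ring.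
Qed.

Lemma ipC f h : ip Omega f h = ip Omega h f.
Proof. by apply: eq_int => x _; rewrite mulrC. Qed.

Lemma ip_linr c f h p : bmeas Omega f -> bmeas Omega h -> bmeas Omega p ->
  ip Omega p (c *: f + h) = c * ip Omega p f + ip Omega p h.
Proof. by move=> bf bh bp; rewrite ipC ip_linl// ipC [ip _ h p]ipC. Qed.

Lemma ip_ge0 f : 0 <= ip Omega f f.
Proof. by apply: Rintegral_ge0 => x _; rewrite -expr2 sqr_ge0. Qed.

Lemma ip_eq0 b f : Pk_fe b Omega Th f -> ip Omega f f = 0 -> f = 0.
Proof.
move=> ff i0; apply: (fe_eq0 ff) => x Ox.
have bf := bmeas_pieces TO (Pk_fe_pieces ff).
have : f x * f x = 0.
  apply: (int_eq0_continuous TO (bmeasM bf bf) _ i0 Ox).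
    by move=> y _; rewrite -expr2 sqr_ge0.
  have c := fe_continuous TO ff Ox.
  have cc : f y * f y @[y --> x] --> f x * f x by apply: cvgM; exact: c.
  exact: cc.
by move/eqP; rewrite mulf_eq0 orbb => /eqP.
Qed.

Definition eip (u v : @vfield R) := I (fun x => ddot (eps Th u x) (eps Th v x)).

Lemma eip_linl (u v w : @vfield R) c : vpieces Th u -> vpieces Th v -> vpieces Th w ->
  eip (c *: u + v) w = c * eip u w + eip v w.
Proof.
move=> pu pv pw; rewrite /eip.
have be := @bmeas_eps _ _ _ TO.
have i1 := bmeas_integ TO (bmeas_ddot (be _ pu) (be _ pw)).
have i2 := bmeas_integ TO (bmeas_ddot (be _ pv) (be _ pw)).
rewrite -(int_lin TO c i1 i2).
by apply: eq_int => x _; rewrite (eps_lin TO)// ddot_linl.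
Qed.

Lemma eip_ge0 u : 0 <= eip u u.
Proof. by apply: Rintegral_ge0 => x _; exact: ddot_ge0. Qed.

(** The integrand is continuous at interior points of cells, so the strain vanishes there, and the
    discrete Korn argument applies. *)
Lemma eip_eq0 u : Vh Omega Th u -> eip u u = 0 -> u = 0.
Proof.
move=> Vu e0; have [p1 p2'] := Vh_pieces Vu.
apply: (Vh_eps_eq0 TO Vu) => x t Ox tTh tx; apply: ddot_eq0.
have be := bmeas_eps TO (conj p1 p2').
apply: (int_eq0_continuous TO (bmeas_ddot be be) _ e0 Ox).
  by move=> y _; exact: ddot_ge0.
pose s y := pd Th i1 u.1 y + pd Th ord0 u.2 y.
(* Written in terms of the four derivatives, whose continuity is known; the two equal off-diagonal
   entries [s / 2] contribute half of [s] squared. *)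
have -> : (fun y => ddot (eps Th u y) (eps Th u y)) =
    fun y => pd Th ord0 u.1 y * pd Th ord0 u.1 y + pd Th i1 u.2 y * pd Th i1 u.2 y
      + 2^-1 * (s y * s y).
  apply/funext => y.
  by rewrite /ddot !big_ord_recl !big_ord0 !mxE /s /vcomp /=; field.
have c1 := pd_continuous TO (j := ord0) p1 tTh tx.
have c2 := pd_continuous TO (j := i1) p1 tTh tx.
have c3 := pd_continuous TO (j := ord0) p2' tTh tx.
have c4 := pd_continuous TO (j := i1) p2' tTh tx.
have cs : s y @[y --> x] --> s x by apply: cvgD; [exact: c2|exact: c3].
have c : pd Th ord0 u.1 y * pd Th ord0 u.1 y + pd Th i1 u.2 y * pd Th i1 u.2 y
      + 2^-1 * (s y * s y) @[y --> x] --> pd Th ord0 u.1 x * pd Th ord0 u.1 x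
      + pd Th i1 u.2 x * pd Th i1 u.2 x + 2^-1 * (s x * s x).
  apply: cvgD; first by apply: cvgD; apply: cvgM; [exact: c1|exact: c1|exact: c4|exact: c4].
  by apply: cvgM; [exact: cvg_cst|apply: cvgM; exact: cs].
exact: c.
Qed.

Section permeability.
Variable K : pt -> 'M[R]_2.
Hypothesis bK : bmeas_mx Omega K.

Definition kip p q := I (fun x => vdot (K x *m grad Th p x) (grad Th q x)).

Lemma grad_lin c p q x : p2_pieces Th p -> p2_pieces Th q ->
  grad Th (fun y => c * p y + q y) x = c *: grad Th p x + grad Th q x.
Proof. by move=> pp pq; apply/colP => j; rewrite !mxE (pd_linear TO). Qed.

Lemma vdot_linl (a b d : 'cV[R]_2) c : vdot (c *: a + b) d = c * vdot a d + vdot b d.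
Proof. by rewrite /vdot mulr_sumr -big_split; apply: eq_bigr => i _; rewrite !mxE /=; ring. Qed.

Lemma vdot_linr (a b d : 'cV[R]_2) c : vdot d (c *: a + b) = c * vdot d a + vdot d b.
Proof. by rewrite /vdot mulr_sumr -big_split; apply: eq_bigr => i _; rewrite !mxE /=; ring. Qed.

Lemma kip_integ p q : p2_pieces Th p -> p2_pieces Th q ->
  integ Omega (fun x => vdot (K x *m grad Th p x) (grad Th q x)).
Proof.
move=> pp pq; apply: (bmeas_integ TO); apply: bmeas_vdot.
  by apply: bmeas_mulmx => //; exact: (bmeas_grad TO).
exact: (bmeas_grad TO).
Qed.

Lemma kip_linl c p q r : p2_pieces Th p -> p2_pieces Th q -> p2_pieces Th r ->
  kip (c *: p + q) r = c * kip p r + kip q r.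
Proof.
move=> pp pq pr; rewrite /kip -(int_lin TO c (kip_integ pp pr) (kip_integ pq pr)).
by apply: eq_int => x _; rewrite grad_lin// mulmxDr -scalemxAr vdot_linl.
Qed.

(* [z] is the gravity term; it makes [darcy] only affine in the pressure [p]. *)
Definition darcy (z : 'cV[R]_2) p q := I (fun x => vdot (K x *m (grad Th p x - z)) (grad Th q x)).

Lemma darcy_integ z p q : p2_pieces Th p -> p2_pieces Th q ->
  integ Omega (fun x => vdot (K x *m (grad Th p x - z)) (grad Th q x)).
Proof.
move=> pp pq; apply: (bmeas_integ TO); apply: bmeas_vdot; last exact: (bmeas_grad TO).
apply: bmeas_mulmx => // i j; under eq_fun do rewrite !mxE.
by apply: bmeasB; [exact: (bmeas_pd TO)|exact: bmeas_cst].
Qed.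

Lemma darcy_linr z c p q r : p2_pieces Th p -> p2_pieces Th q -> p2_pieces Th r ->
  darcy z p (c *: q + r) = c * darcy z p q + darcy z p r.
Proof.
move=> pp pq pr; rewrite /darcy -(int_lin TO c (darcy_integ z pp pq) (darcy_integ z pp pr)).
by apply: eq_int => x _; rewrite grad_lin// vdot_linr.
Qed.

Lemma darcyB z p p' q : p2_pieces Th p -> p2_pieces Th p' -> p2_pieces Th q ->
  darcy z p q - darcy z p' q = kip (p - p') q.
Proof.
move=> pp pp' pq.
have ppd : p2_pieces Th (p - p').
  have := p2_pieces_lin (-1) pp' pp; congr p2_pieces; apply/funext => x.
  by rewrite mulN1r addrC.
have -> : darcy z p q = 1 * kip (p - p') q + darcy z p' q; last by ring.
rewrite /darcy /kip -(int_lin TO 1 (kip_integ ppd pq) (darcy_integ z pp' pq)).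
apply: eq_int => x _; rewrite -vdot_linl scale1r -mulmxDr; congr (vdot (_ *m _) _).
have -> : grad Th p x = grad Th (p - p') x + grad Th p' x.
  have := grad_lin 1 x ppd pp'; rewrite scale1r => <-.
  by congr (grad Th _ x); apply/funext => y; rewrite mul1r -[(p - p') y]/(p y - p' y) subrK.
by rewrite addrA.
Qed.

End permeability.

End forms.

Lemma fst_lin (R : realType) (U V : lmodType R) c (x y : U * V) :
  (c *: x + y).1 = c *: x.1 + y.1.
Proof. by []. Qed.

Lemma snd_lin (R : realType) (U V : lmodType R) c (x y : U * V) :
  (c *: x + y).2 = c *: x.2 + y.2.
Proof. by []. Qed.

Lemma fst_sub (R : realType) (U V : lmodType R) (x y : U * V) : (x - y).1 = x.1 - y.1.
Proof. by []. Qed.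

Lemma fst_scale (R : realType) (U V : lmodType R) c (x : U * V) : (c *: x).1 = c *: x.1.
Proof. by []. Qed.

Lemma fun_lin (R : realType) (T : Type) (f h : T -> R) c t :
  (c *: f + h) t = c * f t + h t.
Proof. by []. Qed.

Lemma fst_sum (R : realType) (U V : lmodType R) d (y : 'I_d -> R) (e : 'I_d -> U * V) :
  (\sum_(i < d) y i *: e i).1 = \sum_(i < d) y i *: (e i).1.
Proof. by rewrite (big_morph fst (id1 := 0) (op1 := +%R)). Qed.

Lemma snd_sum (R : realType) (U V : lmodType R) d (y : 'I_d -> R) (e : 'I_d -> U * V) :
  (\sum_(i < d) y i *: e i).2 = \sum_(i < d) y i *: (e i).2.
Proof. by rewrite (big_morph snd (id1 := 0) (op1 := +%R)). Qed.

(** * One step of the scheme *)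

Section galerkin_step.
Context {R : realType} (Omega : set (@pt R)) (Th : seq (@tri R)).
Hypothesis TO : triangulation Omega Th.
Local Notation pt := (@pt R).
Local Notation I := (Rintegral leb2 Omega).
Local Notation unknowns := (@vfield R * (pt -> R) * (pt -> R))%type.

Lemma Mh_pieces f : Mh Omega Th f -> p2_pieces Th f.
Proof. exact: (@Pk_fe_pieces _ Omega Th false). Qed.

Lemma Mh_subspace : subspace_pred (Mh Omega Th).
Proof. exact: (Pk_fe_subspace Omega Th false). Qed.

Definition fe_space (w : unknowns) :=
  [/\ Vh Omega Th w.1.1, Mh Omega Th w.1.2 & Mh Omega Th w.2].

Lemma fe_space_subspace : subspace_pred fe_space.
Proof.
have [V0 VL] := Vh_subspace TO; have [M0 ML] := Mh_subspace.
split; first exact (And3 V0 M0 M0).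
move=> c x y [x1 x2 x3] [y1 y2 y3]; rewrite /fe_space !fst_lin !snd_lin.
have h1 := VL c _ _ x1 y1; have h2 := ML c _ _ x2 y2; have h3 := ML c _ _ x3 y3.
exact (And3 h1 h2 h3).
Qed.

Definition energy_ip (w z : unknowns) :=
  eip Omega Th w.1.1 z.1.1 + ip Omega w.1.2 z.1.2 + ip Omega w.2 z.2.

Lemma fe_spaceP w : fe_space w -> [/\ vpieces Th w.1.1, p2_pieces Th w.1.2 & p2_pieces Th w.2].
Proof.
by move=> [h1 h2 h3]; split;
  [exact: Vh_pieces h1|exact: (Mh_pieces h2)|exact: (Mh_pieces h3)].
Qed.

Let bp (f : pt -> R) : p2_pieces Th f -> bmeas Omega f := @bmeas_pieces _ _ _ TO f.

Lemma energy_ip_inner : inner_product_on fe_space energy_ip.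
Proof.
split.
- move=> z /fe_spaceP[z1 z2 z3] c x y /fe_spaceP[x1 x2 x3] /fe_spaceP[y1 y2 y3].
  rewrite /energy_ip !fst_lin !snd_lin (eip_linl TO c x1 y1 z1).
  rewrite (ip_linl TO c (bp x2) (bp y2) (bp z2)) (ip_linl TO c (bp x3) (bp y3) (bp z3)).
  rewrite !mulrDr [X in X + _]addrACA [RHS]addrACA; congr (_ + _).
- move=> x y; rewrite /energy_ip.
  have -> : eip Omega Th x.1.1 y.1.1 = eip Omega Th y.1.1 x.1.1.
    by apply: eq_int => t _; exact: ddotC.
  by rewrite (ipC _ x.1.2) (ipC _ x.2).
- by move=> x _; rewrite !addr_ge0 ?ip_ge0 ?eip_ge0.
- move=> x [V1 M2 M3] /eqP.
  rewrite paddr_eq0 ?addr_ge0 ?ip_ge0 ?eip_ge0// paddr_eq0 ?ip_ge0 ?eip_ge0//.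
  move=> /andP[/andP[/eqP h1 /eqP h2] /eqP h3].
  rewrite [x]surjective_pairing [x.1]surjective_pairing.
  by rewrite (eip_eq0 TO V1 h1) (ip_eq0 TO (b := false) M2 h2) (ip_eq0 TO (b := false) M3 h3).
Qed.

(** Concatenates the coefficient rows of the four scalar components and recovers each relation by
    cutting the row back into blocks. *)
Lemma fe_space_coef : exists m (coef : unknowns -> 'rV[R]_m), coef_independent fe_space coef.
Proof.
have [c1 h1] := fe_coef TO true; have [c0 h0] := fe_coef TO false.
exists (size Th * 6 + size Th * 6 + (size Th * 6 + size Th * 6))%N.
exists (fun w => row_mx (row_mx (c1 w.1.1.1) (c1 w.1.1.2)) (row_mx (c0 w.1.2) (c0 w.2))).
move=> d e y Pe e0.
have s1 : \sum_(i < d) y i *: row_mx (c1 (e i).1.1.1) (c1 (e i).1.1.2) = 0.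
  move/(congr1 lsubmx): e0; rewrite linear_sum linear0 => e0; rewrite -[RHS]e0.
  by apply: eq_bigr => i _; rewrite linearZ /= row_mxKl.
have s2 : \sum_(i < d) y i *: row_mx (c0 (e i).1.2) (c0 (e i).2) = 0.
  move/(congr1 rsubmx): e0; rewrite linear_sum linear0 => e0; rewrite -[RHS]e0.
  by apply: eq_bigr => i _; rewrite linearZ /= row_mxKr.
have t1 : \sum_(i < d) y i *: c1 (e i).1.1.1 = 0.
  move/(congr1 lsubmx): s1; rewrite linear_sum linear0 => s1; rewrite -[RHS]s1.
  by apply: eq_bigr => i _; rewrite linearZ /= row_mxKl.
have t2 : \sum_(i < d) y i *: c1 (e i).1.1.2 = 0.
  move/(congr1 rsubmx): s1; rewrite linear_sum linear0 => s1; rewrite -[RHS]s1.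
  by apply: eq_bigr => i _; rewrite linearZ /= row_mxKr.
have t3 : \sum_(i < d) y i *: c0 (e i).1.2 = 0.
  move/(congr1 lsubmx): s2; rewrite linear_sum linear0 => s2; rewrite -[RHS]s2.
  by apply: eq_bigr => i _; rewrite linearZ /= row_mxKl.
have t4 : \sum_(i < d) y i *: c0 (e i).2 = 0.
  move/(congr1 rsubmx): s2; rewrite linear_sum linear0 => s2; rewrite -[RHS]s2.
  by apply: eq_bigr => i _; rewrite linearZ /= row_mxKr.
set w := \sum_(i < d) y i *: e i.
have p1 i : Pk_fe true Omega Th (e i).1.1.1 by case: (Pe i) => -[[]].
have p2' i : Pk_fe true Omega Th (e i).1.1.2 by case: (Pe i) => -[[]].
have p3 i : Pk_fe false Omega Th (e i).1.2 by case: (Pe i).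
have p4 i : Pk_fe false Omega Th (e i).2 by case: (Pe i).
have w1 : w.1.1.1 = 0 by rewrite /w !fst_sum (h1 _ _ _ p1 t1).
have w2 : w.1.1.2 = 0 by rewrite /w !fst_sum snd_sum (h1 _ _ _ p2' t2).
have w3 : w.1.2 = 0 by rewrite /w fst_sum snd_sum (h0 _ _ _ p3 t3).
have w4 : w.2 = 0 by rewrite /w snd_sum (h0 _ _ _ p4 t4).
by rewrite [w]surjective_pairing [w.1]surjective_pairing [w.1.1]surjective_pairing w1 w2 w3 w4.
Qed.

Variables (N : 'M[R]_2 -> 'M[R]_2) (K : pt -> 'M[R]_2) (g : 'cV[R]_2).
Variables (k1 k2 k3 muf dt : R) (theta : bool) (eta_n : pt -> R).
Variables (F : @vfield R -> R) (G : (pt -> R) -> R).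
Hypotheses (k20 : 0 < k2) (k30 : 0 < k3) (muf0 : 0 < muf) (dt0 : 0 < dt).
Hypothesis bN : forall u, vpieces Th u -> bmeas_mx Omega (fun x => N (eps Th u x)).
Hypothesis monoN : strongly_monotone N.
Hypothesis lipN : lipschitz_mx N.
Hypothesis bK : bmeas_mx Omega K.
Hypothesis K0 : forall x z, Omega x -> 0 <= vdot (K x *m z) z.
Hypothesis Weta : Mh Omega Th eta_n.
Hypothesis linF : linear_on (Vh Omega Th) F.
Hypothesis linG : linear_on (Mh Omega Th) G.

Definition stress (u v : @vfield R) := I (fun x => ddot (N (eps Th u x)) (eps Th v x)).

Definition momentum u xi v := stress u v - ip Omega xi (divv Th v) - F v.
Definition mass xi u eta ph := k3 * ip Omega xi ph + ip Omega (divv Th u) ph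
  - k1 * ip Omega (if theta then eta else eta_n) ph.
Definition pressure (w : unknowns) : pt -> R := fun y => k1 * w.1.2 y + k2 * w.2 y.
Definition diffusion (w : unknowns) ps :=
  ip Omega (fun x => (w.2 x - eta_n x) / dt) ps
  + muf^-1 * darcy Omega Th K g (pressure w) ps - G ps.

Definition step_eqs (w : unknowns) :=
  [/\ forall v, Vh Omega Th v -> momentum w.1.1 w.1.2 v = 0,
      forall ph, Mh Omega Th ph -> mass w.1.2 w.1.1 w.2 ph = 0 &
      forall ps, Mh Omega Th ps -> diffusion w ps = 0].

Lemma pressure_lin c x y : pressure (c *: x + y) = c *: pressure x + pressure y.
Proof.
apply/funext => t; rewrite fun_lin /pressure !fst_lin !snd_lin !fun_lin.
by move: (x.1.2 t) (y.1.2 t) (x.2 t) (y.2 t) => *; ring.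
Qed.

Lemma pressure_fe w : fe_space w -> Mh Omega Th (pressure w).
Proof.
have sM := Mh_subspace.
move=> [_ M2 M3].
exact: (sM.2 k1 _ _ M2 (subspace_predZ k2 sM M3)).
Qed.

(* The test function of the third equation is the pressure scaled by [B], so
   that the quadratic forms coming from the three equations add up. *)
Variable B : R.
Hypothesis B0 : 0 < B.

(** The factor [dt] cancels the division in the discrete time derivative, so that the latter
    contributes a plain L2 product. *)
Definition tested (w z : unknowns) := momentum w.1.1 w.1.2 z.1.1
  + mass w.1.2 w.1.1 w.2 z.1.2 + dt * diffusion w (B *: pressure z).

(** What a difference of two [tested] values contains besides the stress. Loads, gravity and [eta_n]
    have cancelled, which is why the [eta] term of the second equation survives only in the implicit
    case. *)
Definition coupling (d z : unknowns) :=
  - ip Omega d.1.2 (divv Th z.1.1) + k3 * ip Omega d.1.2 z.1.2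
  + ip Omega (divv Th d.1.1) z.1.2 - (if theta then k1 * ip Omega d.2 z.1.2 else 0)
  + (ip Omega d.2 (B *: pressure z)
     + dt * (muf^-1 * kip Omega Th K (pressure d) (B *: pressure z))).

Lemma stress_linr u : vpieces Th u -> linear_on (vpieces Th) (stress u).
Proof.
move=> pu c v w pv pw; rewrite /stress.
have i1 := bmeas_integ TO (bmeas_ddot (bN pu) (bmeas_eps TO pv)).
have i2 := bmeas_integ TO (bmeas_ddot (bN pu) (bmeas_eps TO pw)).
rewrite -(int_lin TO c i1 i2).
by apply: eq_int => x _; rewrite (eps_lin TO)// ddot_linr.
Qed.

Lemma ip_divr xi : bmeas Omega xi ->
  linear_on (vpieces Th) (fun v => ip Omega xi (divv Th v)).
Proof.
move=> bx c v w pv pw.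
have b1 := bmeas_divv TO pv; have b2 := bmeas_divv TO pw.
rewrite -(ip_linr TO c b1 b2 bx); congr (ip _ _ _).
by apply/funext => x; rewrite (divv_lin TO).
Qed.

Lemma ip_divl ph : bmeas Omega ph ->
  linear_on (vpieces Th) (fun v => ip Omega (divv Th v) ph).
Proof.
move=> bx c v w pv pw; rewrite -!(ipC _ ph); exact: (ip_divr bx c pv pw).
Qed.

Lemma linear_onW (W : lmodType R) (P P' : W -> Prop) (l : W -> R) :
  (forall x, P x -> P' x) -> linear_on P' l -> linear_on P l.
Proof. by move=> PP' ll c x y /PP' Px /PP' Py; exact: ll. Qed.

Lemma ip_linear_onr p : bmeas Omega p -> linear_on (p2_pieces Th) (ip Omega p).
Proof. by move=> b c x y px py; exact: (ip_linr TO c (bp px) (bp py) b). Qed.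

Lemma ip_linear_onl p : bmeas Omega p -> linear_on (p2_pieces Th) (fun f => ip Omega f p).
Proof. by move=> b c x y px py; exact: (ip_linl TO c (bp px) (bp py) b). Qed.

Lemma bmeas_rate w : fe_space w -> bmeas Omega (fun x => (w.2 x - eta_n x) / dt).
Proof.
move=> /fe_spaceP[_ _ p3]; apply: bmeasM; last exact: bmeas_cst.
by apply: bmeasB; apply: bp => //; exact: (Mh_pieces Weta).
Qed.

Lemma momentum_linear w : fe_space w -> linear_on (Vh Omega Th) (momentum w.1.1 w.1.2).
Proof.
move=> /fe_spaceP[p1 p2' p3]; apply: linear_on_sub => //; apply: linear_on_sub.
  by apply: linear_onW (stress_linr p1); exact: Vh_pieces.
by apply: linear_onW (ip_divr (bp p2')); exact: Vh_pieces.
Qed.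

Lemma mass_linear w : fe_space w -> linear_on (Mh Omega Th) (mass w.1.2 w.1.1 w.2).
Proof.
move=> /fe_spaceP[p1 p2' p3].
apply: (linear_onW Mh_pieces).
apply: linear_on_sub; first apply: linear_on_add.
- by apply: linear_on_scale; apply: ip_linear_onr; exact: bp.
- by apply: ip_linear_onr; exact: (bmeas_divv TO).
- apply: linear_on_scale; apply: ip_linear_onr; apply: bp.
  by case: theta => //; exact: (Mh_pieces Weta).
Qed.

Lemma diffusion_linear w : fe_space w -> linear_on (Mh Omega Th) (diffusion w).
Proof.
move=> Pw; apply: linear_on_sub => //.
apply: (linear_onW Mh_pieces).
apply: linear_on_add; first by apply: ip_linear_onr; exact: bmeas_rate.
apply: linear_on_scale => c x y px py.
exact: (darcy_linr TO bK _ c (Mh_pieces (pressure_fe Pw)) px py).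
Qed.

Lemma scaled_pressure_fe w : fe_space w -> Mh Omega Th (B *: pressure w).
Proof.
by move=> /pressure_fe; apply: subspace_predZ; exact: Mh_subspace.
Qed.

Lemma scaled_pressure_lin c x y :
  B *: pressure (c *: x + y) = c *: (B *: pressure x) + B *: pressure y.
Proof. by rewrite pressure_lin scalerDr !scalerA mulrC. Qed.

Lemma tested_linear w : fe_space w -> linear_on fe_space (tested w).
Proof.
move=> Pw; apply: linear_on_add; first apply: linear_on_add.
- apply: (linear_on_comp (h := fun z : unknowns => z.1.1) _ _ (momentum_linear Pw)) => //.
  by move=> x [].
- apply: (linear_on_comp (h := fun z : unknowns => z.1.2) _ _ (mass_linear Pw)) => //.
  by move=> x [].
- apply: linear_on_scale.
  apply: (linear_on_comp (h := fun z : unknowns => B *: pressure z) _ _ (diffusion_linear Pw)).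
    exact: scaled_pressure_fe.
  exact: scaled_pressure_lin.
Qed.

Lemma coupling_linear z : fe_space z -> linear_on fe_space (coupling^~ z).
Proof.
move=> Pz; have [q1 q2 q3] := fe_spaceP Pz.
have pB := Mh_pieces (scaled_pressure_fe Pz).
have bdz := bmeas_divv TO q1.
have pr2 (w : unknowns) : fe_space w -> p2_pieces Th w.1.2 by move=> /fe_spaceP[].
have pr3 (w : unknowns) : fe_space w -> p2_pieces Th w.2 by move=> /fe_spaceP[].
have pr1 (w : unknowns) : fe_space w -> vpieces Th w.1.1 by move=> /fe_spaceP[].
apply: linear_on_add.
  apply: linear_on_sub.
    apply: linear_on_add; first apply: linear_on_add.
    - apply: linear_on_opp.
      exact: (linear_on_comp (h := fun w : unknowns => w.1.2) pr2
        (fun c x y => erefl) (ip_linear_onl bdz)).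
    - apply: linear_on_scale.
      exact: (linear_on_comp (h := fun w : unknowns => w.1.2) pr2
        (fun c x y => erefl) (ip_linear_onl (bp q2))).
    - exact: (linear_on_comp (h := fun w : unknowns => w.1.1) pr1 _ (ip_divl (bp q2))).
  case: theta; last by move=> c x y _ _ /=; rewrite mulr0 addr0.
  apply: linear_on_scale.
  exact: (linear_on_comp (h := fun w : unknowns => w.2) pr3 _ (ip_linear_onl (bp q2))).
apply: linear_on_add.
  exact: (linear_on_comp (h := fun w : unknowns => w.2) pr3 _ (ip_linear_onl (bp pB))).
apply: linear_on_scale; apply: linear_on_scale => c x y Px Py.
rewrite pressure_lin.
exact: (kip_linl TO bK c (Mh_pieces (pressure_fe Px)) (Mh_pieces (pressure_fe Py)) pB).
Qed.

Lemma testedB x y z : fe_space x -> fe_space y -> fe_space z ->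
  tested x z - tested y z = stress x.1.1 z.1.1 - stress y.1.1 z.1.1 + coupling (x - y) z.
Proof.
move=> Px Py Pz.
have [x1 x2 x3] := fe_spaceP Px; have [y1 y2 y3] := fe_spaceP Py.
have [z1 z2 z3] := fe_spaceP Pz.
have pB := Mh_pieces (scaled_pressure_fe Pz).
have d1 := linear_onB (ip_linear_onl (bmeas_divv TO z1)) x2 y2.
have d2 := linear_onB (ip_linear_onl (bp z2)) x2 y2.
have d3 := linear_onB (ip_divl (bp z2)) x1 y1.
have d4 := linear_onB (ip_linear_onl (bp z2)) x3 y3.
have d5 := linear_onB (ip_linear_onl (bp pB)) x3 y3.
have d6 := darcyB TO bK g (Mh_pieces (pressure_fe Px)) (Mh_pieces (pressure_fe Py)) pB.
(* Brings [dt^-1] outside the integral, where the factor of [tested] can cancel it. *)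
have rate w : fe_space w -> ip Omega (fun t => (w.2 t - eta_n t) / dt) (B *: pressure z) =
    dt^-1 * (ip Omega w.2 (B *: pressure z) - ip Omega eta_n (B *: pressure z)).
  move=> Pw; have [_ _ w3] := fe_spaceP Pw.
  have en := Mh_pieces Weta.
  rewrite -(linear_onB (ip_linear_onl (bp pB)) w3 en).
  have i := bmeas_integ TO (bmeasM (bmeasB (bp w3) (bp en)) (bp pB)).
  have := int_lin TO dt^-1 i (bmeas_integ TO (bmeas_cst Omega 0)).
  rewrite (int_cst0 TO) addr0 => e; rewrite -[RHS]e.
  by apply: eq_int => t _; rewrite addr0 mulrAC mulrC.
rewrite /tested /momentum /mass /diffusion /coupling !rate//.
rewrite -[(x - y).1.2]/(x.1.2 - y.1.2) -[(x - y).1.1]/(x.1.1 - y.1.1) -[(x - y).2]/(x.2 - y.2).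
rewrite d1 d2 d3 d4 d5.
have -> : pressure (x - y) = pressure x - pressure y.
  by rewrite addrC -scaleN1r pressure_lin scaleN1r addrC.
rewrite -d6.
move: (stress x.1.1 z.1.1) (stress y.1.1 z.1.1) (F z.1.1).
move: (ip Omega x.1.2 (divv Th z.1.1)) (ip Omega y.1.2 (divv Th z.1.1)).
move: (ip Omega x.1.2 z.1.2) (ip Omega y.1.2 z.1.2).
move: (ip Omega (divv Th x.1.1) z.1.2) (ip Omega (divv Th y.1.1) z.1.2).
move: (ip Omega x.2 (B *: pressure z)) (ip Omega y.2 (B *: pressure z)).
move: (ip Omega eta_n (B *: pressure z)) (G (B *: pressure z)).
move: (darcy Omega Th K g (pressure x) _) (darcy Omega Th K g (pressure y) _).
case: theta; [|move: (ip Omega eta_n z.1.2)]; last first.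
  by move=> *; field; rewrite !gt_eqF.
by move: (ip Omega x.2 z.1.2) (ip Omega y.2 z.1.2) => *; field; rewrite !gt_eqF.
Qed.

(** On the diagonal the two divergence terms cancel, and the permeability term, with the same
    pressure in both slots, is nonnegative and is dropped. *)
Lemma coupling_diag d : fe_space d ->
  k3 * ip Omega d.1.2 d.1.2 - (if theta then k1 * ip Omega d.2 d.1.2 else 0)
  + B * (k1 * ip Omega d.2 d.1.2 + k2 * ip Omega d.2 d.2) <= coupling d d.
Proof.
move=> Pd; have [p1 p2' p3] := fe_spaceP Pd.
have pp := Mh_pieces (pressure_fe Pd).
have sP := Mh_subspace.
have e1 : ip Omega d.2 (B *: pressure d) = B * (k1 * ip Omega d.2 d.1.2 + k2 * ip Omega d.2 d.2).
  have := linear_onZ B sP (linear_onW Mh_pieces (ip_linear_onr (bp p3))) (pressure_fe Pd).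
  move=> ->; congr (_ * _).
  have p2k : p2_pieces Th (k2 *: d.2).
    exact: Mh_pieces (subspace_predZ k2 sP (let: And3 _ _ h := Pd in h)).
  have := ip_linear_onr (bp p3) k1 p2' p2k.
  have [_ _ M3] := Pd.
  have -> := linear_onZ k2 sP (linear_onW Mh_pieces (ip_linear_onr (bp p3))) M3.
  by [].
have e2 : 0 <= kip Omega Th K (pressure d) (B *: pressure d).
  apply: Rintegral_ge0 => x Ox.
  have -> : grad Th (B *: pressure d) x = B *: grad Th (pressure d) x + 0.
    have p0 := Mh_pieces sP.1.
    have := grad_lin TO B x pp p0.
    have -> : grad Th 0 x = 0.
      have := grad_lin TO (-1) x p0 p0.
      have -> : (fun y => -1 * (0 : pt -> R) y + (0 : pt -> R) y) = 0.
        by apply/funext => y; rewrite mulN1r addNr.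
      by rewrite scaleN1r addNr.
    move=> <-; congr (grad Th _ x); apply/funext => y.
    by rewrite -[RHS]/(B * pressure d y + 0) addr0.
  rewrite vdot_linr.
  have -> : vdot (K x *m grad Th (pressure d) x) 0 = 0.
    by rewrite /vdot big1// => i _; rewrite [X in _ * X]mxE mulr0.
  by rewrite addr0 mulr_ge0 ?K0// ltW.
have e3 : 0 <= dt * (muf^-1 * kip Omega Th K (pressure d) (B *: pressure d)).
  by rewrite mulr_ge0 ?(ltW dt0)// mulr_ge0// invr_ge0 ltW.
rewrite /coupling e1 [ip Omega d.1.2 (divv Th d.1.1)]ipC; lra.
Qed.

Lemma eps_sub u v x : vpieces Th u -> vpieces Th v ->
  eps Th (u - v) x = eps Th u x - eps Th v x.
Proof. by move=> pu pv; rewrite addrC -scaleN1r (eps_lin TO)// scaleN1r addrC. Qed.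

Lemma vpieces_sub u v : vpieces Th u -> vpieces Th v -> vpieces Th (u - v).
Proof.
move=> [u1 u2] [v1 v2]; rewrite addrC -scaleN1r.
have h1 := p2_pieces_lin (-1) v1 u1; have h2 := p2_pieces_lin (-1) v2 u2.
exact (conj h1 h2).
Qed.

Lemma stressB_int u v w : vpieces Th u -> vpieces Th v -> vpieces Th w ->
  stress u w - stress v w = I (fun x => ddot (N (eps Th u x) - N (eps Th v x)) (eps Th w x))
  /\ integ Omega (fun x => ddot (N (eps Th u x) - N (eps Th v x)) (eps Th w x)).
Proof.
move=> pu pv pw; rewrite /stress.
have bw := bmeas_eps TO pw.
have iu := bmeas_integ TO (bmeas_ddot (bN pu) bw).
have iv := bmeas_integ TO (bmeas_ddot (bN pv) bw).
have e x : ddot (N (eps Th u x) - N (eps Th v x)) (eps Th w x) =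
    -1 * ddot (N (eps Th v x)) (eps Th w x) + ddot (N (eps Th u x)) (eps Th w x).
  by rewrite addrC -scaleN1r ddot_linl.
split; last by under eq_fun do rewrite e; exact: (integ_lin TO (-1) iv iu).
by rewrite (eq_int (fun x _ => e x)) (int_lin TO (-1) iv iu) mulN1r addrC.
Qed.

Lemma stress_monotone : exists2 C, 0 < C & forall u v, vpieces Th u -> vpieces Th v ->
  C * eip Omega Th (u - v) (u - v) <= stress u (u - v) - stress v (u - v).
Proof.
have [C [C0 mono]] := monoN; exists C => // u v pu pv.
have pw := vpieces_sub pu pv.
have [-> ii] := stressB_int pu pv pw.
have ie := bmeas_integ TO (bmeas_ddot (bmeas_eps TO pw) (bmeas_eps TO pw)).
have e := int_lin TO C ie (bmeas_integ TO (bmeas_cst Omega 0)).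
rewrite (int_cst0 TO) addr0 in e; rewrite /eip -e.
apply: (int_le TO _ ii); first exact: (integ_lin TO C ie (bmeas_integ TO (bmeas_cst Omega 0))).
by move=> x _; rewrite addr0 eps_sub//; apply: mono; exact: sym_eps.
Qed.

(** The L1 seminorm of the strain, which plays the part of [nu] in [strongly_monotone_solvable]. *)
Definition eps_l1 (w : unknowns) := I (fun x => abs_sum (eps Th w.1.1 x)).

Lemma bmeas_abs_sum (A : pt -> 'M[R]_2) : bmeas_mx Omega A ->
  bmeas Omega (fun x => abs_sum (A x)).
Proof.
by move=> bA; apply: bmeas_sum => i; apply: bmeas_sum => j; exact: bmeas_norm.
Qed.

(** The strain of the fixed test field [v] is bounded, so the pointwise Lipschitz bound integrates
    to an L1 bound with a constant depending on [v]. *)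
Lemma stress_lipschitz v : vpieces Th v -> exists2 C, 0 <= C & forall x y,
  vpieces Th x -> vpieces Th y ->
  `|stress x v - stress y v| <= C * I (fun t => abs_sum (eps Th (x - y) t)).
Proof.
move=> pv; have [L [L0 lip]] := lipN.
have [_ [M hM]] := bmeas_abs_sum (bmeas_eps TO pv).
exists (L * `|M|); first by rewrite mulr_ge0// ltW.
move=> x y px py; have pw := vpieces_sub px py.
have [-> ii] := stressB_int px py pv.
have ia := bmeas_integ TO (bmeas_abs_sum (bmeas_eps TO pw)).
have i0 := bmeas_integ TO (bmeas_cst Omega 0).
have e := int_lin TO (L * `|M|) ia i0.
rewrite (int_cst0 TO) addr0 in e; rewrite -e.
rewrite (le_trans (int_norm TO ii))//.
apply: (int_le TO); [exact: (integrable_norm ii)|exact: (integ_lin TO _ ia i0)|].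
move=> t Ot; rewrite addr0 (le_trans (ddot_le _ _))// mulrAC.
apply: ler_pM; rewrite ?sqrtr_ge0 ?abs_sum_ge0//.
  rewrite (le_trans (lip _ _ (sym_eps _ _ _) (sym_eps _ _ _)))//.
  by rewrite ler_wpM2l ?(ltW L0)// eps_sub// frobenius_le_abs_sum.
by rewrite (le_trans (ler_norm _))// (le_trans (hM t Ot))// ler_norm.
Qed.

Variable c : R.
Hypothesis c0 : 0 < c.
Hypothesis coercive : forall X Y Z, 0 <= X -> 0 <= Z ->
  (forall s, 0 <= X + 2 * s * Y + s ^+ 2 * Z) ->
  c * (X + Z) <= k3 * X - (if theta then k1 * Y else 0) + B * (k1 * Y + k2 * Z).

(** The expansion of the square of [f + s h]; it stands in for Cauchy-Schwarz in the coercivity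
    estimate. *)
Lemma ip_quadratic f h s : p2_pieces Th f -> p2_pieces Th h ->
  0 <= ip Omega f f + 2 * s * ip Omega h f + s ^+ 2 * ip Omega h h.
Proof.
move=> pf ph; have := ip_ge0 Omega (s *: h + f).
have psum : p2_pieces Th (s *: h + f) by exact: (p2_pieces_lin s ph pf).
rewrite (ip_linl TO s (bp ph) (bp pf) (bp psum)).
rewrite (ip_linr TO s (bp ph) (bp pf) (bp ph)) (ip_linr TO s (bp ph) (bp pf) (bp pf)).
rewrite [ip Omega f h]ipC.
by move: (ip _ f f) (ip _ h f) (ip _ h h) => X Y Z; congr (0 <= _); ring.
Qed.

Lemma tested_monotone : exists2 C, 0 < C & forall x y, fe_space x -> fe_space y ->
  C * energy_ip (x - y) (x - y) <= tested x (x - y) - tested y (x - y).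
Proof.
have [C C0 mono] := stress_monotone.
exists (Num.min C c); first by rewrite lt_min C0.
move=> x y Px Py; have Pd := subspace_predB fe_space_subspace Px Py.
rewrite testedB//.
have [x1 _ _] := fe_spaceP Px; have [y1 _ _] := fe_spaceP Py.
have [d1 d2 d3] := fe_spaceP Pd.
have := mono _ _ x1 y1.
have -> : x.1.1 - y.1.1 = (x - y).1.1.
  by rewrite !fst_sub.
have := le_trans (coercive (ip_ge0 Omega _) (ip_ge0 Omega _) (fun s => ip_quadratic s d2 d3))
  (coupling_diag Pd).
rewrite /energy_ip.
have := eip_ge0 Omega Th (x - y).1.1; have := ip_ge0 Omega (x - y).1.2.
have := ip_ge0 Omega (x - y).2.
move: (eip _ _ _ _) (ip _ (x - y).1.2 _) (ip _ (x - y).2 _) (coupling _ _) => X Y Z W.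
move: (stress x.1.1 _ - _) => S Z0 Y0 X0 h1 h2.
have m1 : Num.min C c * X <= C * X by rewrite ler_wpM2r// ge_min lexx.
have m2 : Num.min C c * (Y + Z) <= c * (Y + Z).
  by rewrite ler_wpM2r ?addr_ge0// ge_min lexx orbT.
by lra.
Qed.

Lemma step_eqs_tested w z : fe_space z -> step_eqs w -> tested w z = 0.
Proof.
move=> Pz [h1 h2 h3]; have [z1 z2 z3] := Pz; rewrite /tested h1// h2//.
by rewrite h3 ?mulr0 ?addr0//; exact: scaled_pressure_fe.
Qed.

(** Each equation is isolated by a test triple that annihilates the other two. *)
Lemma tested_step_eqs w : fe_space w -> (forall z, fe_space z -> tested w z = 0) ->
  step_eqs w.
Proof.
move=> Pw tw.
have [V0 _] := Vh_subspace TO; have [M0 _] := Mh_subspace.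
have l1 := linear_on0 (Vh_subspace TO) (momentum_linear Pw).
have l2 := linear_on0 Mh_subspace (mass_linear Pw).
have l3 := linear_on0 Mh_subspace (diffusion_linear Pw).
split.
- move=> v Vv; have := tw ((v, 0), 0) (And3 Vv M0 M0).
  rewrite /tested /= l2 addr0.
  have -> : B *: pressure ((v, 0), 0) = 0.
    by apply/funext => t; rewrite -[LHS]/(B * (k1 * 0 + k2 * 0)) !mulr0 addr0 mulr0.
  by rewrite l3 mulr0 addr0.
- move=> ph Mph.
  (* The last component makes the test pressure vanish, which removes the third equation; it is
     admissible because both scalar spaces are the same. *)
  have := tw ((0, ph), - (k1 / k2) *: ph) (And3 V0 Mph (subspace_predZ _ Mh_subspace Mph)).
  rewrite /tested /= l1 add0r.
  have -> : B *: pressure ((0, ph), - (k1 / k2) *: ph) = 0.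
    apply/funext => t; rewrite -[LHS]/(B * (k1 * ph t + k2 * (- (k1 / k2) * ph t))).
    by rewrite mulNr mulrN mulrA mulrCA mulfV ?gt_eqF// mulr1 subrr mulr0.
  by rewrite l3 mulr0 addr0.
- move=> ps Mps.
  (* Normalised so that the scaled test pressure is exactly [ps]. *)
  have := tw ((0, 0), (B * k2)^-1 *: ps) (And3 V0 M0 (subspace_predZ _ Mh_subspace Mps)).
  rewrite /tested /= l1 l2 !add0r.
  have -> : B *: pressure ((0, 0), (B * k2)^-1 *: ps) = ps.
    apply/funext => t; rewrite -[LHS]/(B * (k1 * 0 + k2 * ((B * k2)^-1 * ps t))).
    by rewrite mulr0 add0r !mulrA mulfV ?mul1r// mulf_neq0// gt_eqF.
  by move/eqP; rewrite mulf_eq0 gt_eqF//= => /eqP.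
Qed.

(** Testing both solutions with their difference leaves zero on the right of the monotonicity
    estimate, so the energy of the difference vanishes. *)
Lemma step_eqs_unique w w' : fe_space w -> fe_space w' -> step_eqs w -> step_eqs w' -> w' = w.
Proof.
move=> Pw Pw' hw hw'; have [C C0 mono] := tested_monotone.
have Pd := subspace_predB fe_space_subspace Pw' Pw.
have := mono _ _ Pw' Pw; rewrite !step_eqs_tested// subrr pmulr_rle0// => le0.
have [_ _ Q0 Qdef] := energy_ip_inner.
have /Qdef : energy_ip (w' - w) (w' - w) = 0 by apply/eqP; rewrite eq_le le0 Q0.
by move=> /(_ Pd) /eqP; rewrite subr_eq0 => /eqP.
Qed.

Lemma step_eqs_exists : exists2 w, fe_space w & step_eqs w.
Proof.
have [C C0 mono] := tested_monotone.
have [m [coef ind]] := fe_space_coef.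
have fst11 (x y : unknowns) : (x - y).1.1 = x.1.1 - y.1.1.
  by rewrite !fst_sub.
have beps x : fe_space x -> bmeas Omega (fun t => abs_sum (eps Th x.1.1 t)).
  by move=> /fe_spaceP[p1 _ _]; apply: bmeas_abs_sum; exact: (bmeas_eps TO).
have [|x y Px Py|v Pv|w Pw tw] := @strongly_monotone_solvable R _ fe_space energy_ip m coef
    tested coupling eps_l1 C fe_space_subspace energy_ip_inner ind C0 tested_linear mono
    coupling_linear.
- move=> s x Px; have [p1 _ _] := fe_spaceP Px.
  have i0 := bmeas_integ TO (bmeas_cst Omega 0).
  have := int_lin TO `|s| (bmeas_integ TO (beps x Px)) i0.
  rewrite (int_cst0 TO) addr0 -/(eps_l1 x) => <-.
  rewrite /eps_l1 le_eqVlt; apply/orP; left; apply/eqP; apply: eq_int => t _.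
  rewrite addr0 -abs_sumZ; congr abs_sum.
  have p0 := Vh_pieces (Vh_subspace TO).1.
  rewrite !fst_scale -[s *: x.1.1]addr0 (eps_lin TO)//.
  have -> : eps Th 0 t = 0.
    by have := eps_sub t p0 p0; rewrite !subrr.
  by rewrite addr0.
- have [p1 _ _] := fe_spaceP Px; have [q1 _ _] := fe_spaceP Py.
  have := int_lin TO 1 (bmeas_integ TO (beps x Px)) (bmeas_integ TO (beps y Py)).
  rewrite mul1r -/(eps_l1 x) -/(eps_l1 y) => <-.
  have Pxy : fe_space (x + y).
    by rewrite -[x]scale1r; exact (fe_space_subspace.2 1 x y Px Py).
  apply: (int_le TO); first exact: (bmeas_integ TO (beps _ Pxy)).
    exact: (integ_lin TO 1 (bmeas_integ TO (beps x Px)) (bmeas_integ TO (beps y Py))).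
  move=> t _; rewrite mul1r -[x]scale1r !fst_lin (eps_lin TO)// scale1r scale1r.
  exact: abs_sumD.
- have [v1 _ _] := fe_spaceP Pv; have [C1 C10 lip] := stress_lipschitz v1.
  exists C1 => // x y Px Py.
  have [p1 _ _] := fe_spaceP Px; have [q1 _ _] := fe_spaceP Py.
  (* Once the coupling is subtracted, only the difference of the stresses is left to estimate. *)
  by rewrite testedB// addrK /eps_l1 fst11; exact: lip.
- by exists w => //; exact: tested_step_eqs.
Qed.

End galerkin_step.

(** * Linearity of the load functionals *)

Section loads.
Context {R : realType} (Omega : set (@pt R)) (Th : seq (@tri R)).
Hypothesis TO : triangulation Omega Th.
Local Notation pt := (@pt R).

Lemma load_linear (f f1 : @vfield R) : L2dom Omega f.1 -> L2dom Omega f.2 ->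
  L2bnd Th f1.1 -> L2bnd Th f1.2 ->
  linear_on (Vh Omega Th) (fun v => ipv Omega f v + bipv Th f1 v).
Proof.
move=> Lf1 Lf2 Lb1 Lb2.
have body : linear_on (Vh Omega Th) (ipv Omega f).
  move=> c v w Vv Vw.
  have [v1 v2] := Vh_pieces Vv; have [w1 w2] := Vh_pieces Vw.
  have ii z : vpieces Th z -> integ Omega (fun x => f.1 x * z.1 x + f.2 x * z.2 x).
    move=> [z1 z2].
    have h1 := integ_L2M TO Lf1 (bmeas_pieces TO z1).
    have h2 := integ_L2M TO Lf2 (bmeas_pieces TO z2).
    by have := integ_lin TO 1 h1 h2; under eq_fun do rewrite mul1r.
  rewrite /ipv -(int_lin TO c (ii v (conj v1 v2)) (ii w (conj w1 w2))).
  by apply: eq_int => x _; rewrite !(fst_lin, snd_lin) !fun_lin; ring.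
apply: linear_on_add => // c v w Vv Vw.
have [v1 v2] := Vh_pieces Vv; have [w1 w2] := Vh_pieces Vw.
by rewrite /bipv (bip_lin c Lb1 v1 w1) (bip_lin c Lb2 v2 w2) mulrDr addrACA.
Qed.

Lemma source_linear (phi phi1 : pt -> R) : L2dom Omega phi -> L2bnd Th phi1 ->
  linear_on (Mh Omega Th) (fun ps => ip Omega phi ps + bip Th phi1 ps).
Proof.
move=> Lp Lb.
have body : linear_on (Mh Omega Th) (ip Omega phi).
  move=> c v w Mv Mw.
  have ii z : Mh Omega Th z -> integ Omega (fun x => phi x * z x).
    by move=> /Mh_pieces pz; apply: (integ_L2M TO Lp); exact: (bmeas_pieces TO pz).
  rewrite /ip -(int_lin TO c (ii v Mv) (ii w Mw)).
  by apply: eq_int => x _; rewrite fun_lin; ring.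
apply: linear_on_add => // c v w Mv Mw.
exact: (bip_lin c Lb (Mh_pieces Mv) (Mh_pieces Mw)).
Qed.

End loads.

Theorem theorem3p4 (R : realType) (Omega : set (@pt R)) (Th : seq (@tri R))
  (T : R) (Nt : nat)
  (lambda mu alpha c0 muf rhof : R) (g : 'cV[R]_2)
  (K : @pt R -> 'M[R]_2) (K1 K2 : R)
  (kappa k0 k1 a1 a2 a3 : R) (Phi : R -> R)
  (f f1 : R -> @vfield R) (phi phi1 : @pt R -> R) :
  triangulation Omega Th ->
  0 < T -> (0 < Nt)%N ->
  0 < lambda -> 0 < mu -> 0 < alpha -> 0 < c0 -> 0 < muf ->
  (* permeability tensor *)
  0 < K1 -> 0 < K2 ->
  (forall x, Omega x -> (K x)^T = K x) ->
  (forall i j, measurable_fun Omega (fun x => K x i j)) ->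
  (forall x (z : 'cV[R]_2), Omega x ->
     K1 * vdot z z <= vdot (K x *m z) z /\ vdot (K x *m z) z <= K2 * vdot z z) ->
  (* Hencky-Mises constitutive assumptions *)
  0 < k0 -> k0 <= kappa -> kappa <= k1 ->
  0 < a1 -> 0 < a2 -> 0 < a3 ->
  (forall x, derivable Phi x 1) -> (forall x, derivable (derive1 Phi) x 1) ->
  continuous (derive1 (derive1 Phi)) ->
  (forall rho, 0 <= rho ->
     [/\ a1 <= mu * derive1 Phi rho, mu * derive1 Phi rho < kappa,
         `|rho * derive1 (derive1 Phi) rho| <= a2 &
         a3 <= derive1 Phi rho + 2 * rho * derive1 (derive1 Phi) rho]) ->
  strongly_monotone (Nop kappa mu lambda Phi) ->
  lipschitz_mx (Nop kappa mu lambda Phi) ->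
  (* data *)
  (forall t, L2dom Omega (f t).1 /\ L2dom Omega (f t).2) ->
  (forall t, L2bnd Th (f1 t).1 /\ L2bnd Th (f1 t).2) ->
  L2dom Omega phi -> L2bnd Th phi1 ->
  forall (n : nat) (theta : bool) (eta_n : @pt R -> R),
  Wh Omega Th eta_n ->
  let dt := T / Nt%:R in
  let tn1 := n.+1%:R * dt in
  (exists (u : @vfield R) (xi eta : @pt R -> R),
     [/\ Vh Omega Th u, Mh Omega Th xi, Wh Omega Th eta &
         mfem_step Omega Th lambda mu kappa alpha c0 muf rhof g K Phi f f1
           phi phi1 dt tn1 theta eta_n u xi eta]) /\
  (forall (u u' : @vfield R) (xi xi' eta eta' : @pt R -> R),
     Vh Omega Th u -> Mh Omega Th xi -> Wh Omega Th eta ->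
     mfem_step Omega Th lambda mu kappa alpha c0 muf rhof g K Phi f f1
           phi phi1 dt tn1 theta eta_n u xi eta ->
     Vh Omega Th u' -> Mh Omega Th xi' -> Wh Omega Th eta' ->
     mfem_step Omega Th lambda mu kappa alpha c0 muf rhof g K Phi f f1
           phi phi1 dt tn1 theta eta_n u' xi' eta' ->
     [/\ u' = u, xi' = xi & eta' = eta]).
Proof.
move=> TO T0 Nt0 la0 mu0 al0 c00 muf0 K10 _ symK mK ellK _ _ _ a10 _ _ _ dPhi _ hPhi
  monoN lipN Lf Lf1 Lphi Lphi1 n theta eta_n Weta dt tn1.
pose kk1 := kap1 lambda alpha c0; pose kk2 := kap2 lambda alpha c0.
pose kk3 := kap3 lambda alpha c0.
have den0 : 0 < lambda * alpha ^+ 2 + c0.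
  by rewrite addr_gt0// mulr_gt0// exprn_gt0.
have kk20 : 0 < kk2 by rewrite /kk2 /kap2 invr_gt0.
have kk30 : 0 < kk3 by rewrite /kk3 /kap3 divr_gt0// mulr_gt0.
have dt0 : 0 < dt by rewrite /dt divr_gt0// ltr0n.
have bN u : vpieces Th u ->
    bmeas_mx Omega (fun x => Nop kappa mu lambda Phi (eps Th u x)).
  move=> pu; apply: (bmeas_Nop lambda mu0 a10 dPhi) (sym_eps Th u) (bmeas_eps TO pu).
  by move=> rho /hPhi[].
have bK := bmeas_elliptic K10 symK mK ellK.
have K0 x z : Omega x -> 0 <= vdot (K x *m z) z.
  move=> Ox; have [h _] := ellK x z Ox; rewrite (le_trans _ h)// mulr_ge0 ?(ltW K10)//.
  by apply: sumr_ge0 => i _; rewrite -expr2 sqr_ge0.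
have [B [c [B0 cpos coer]]] := coupling_coercive kk1 theta kk20 kk30.
have linF := load_linear TO (Lf tn1).1 (Lf tn1).2 (Lf1 tn1).1 (Lf1 tn1).2.
have linG := source_linear TO Lphi Lphi1.
pose N := Nop kappa mu lambda Phi.
(* The residual form of the scheme: the gravity vector is [rhof *: g], and the right-hand sides
   enter as linear functionals that [stepE] moves back across the equations. *)
pose eqs := step_eqs Omega Th N K (rhof *: g) kk1 kk2 kk3 muf dt theta eta_n
  (fun v => ipv Omega (f tn1) v + bipv Th (f1 tn1) v)
  (fun ps => ip Omega phi ps + bip Th phi1 ps).
have stepE u xi eta : eqs ((u, xi), eta) <-> mfem_step Omega Th lambda mu kappa alpha c0
    muf rhof g K Phi f f1 phi phi1 dt tn1 theta eta_n u xi eta.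
  by split=> -[h1 h2 h3]; split=> w Mw;
    [have /eqP := h1 w Mw|have /eqP := h2 w Mw|have /eqP := h3 w Mw
    |apply/eqP; have := h1 w Mw|apply/eqP; have := h2 w Mw|apply/eqP; have := h3 w Mw];
    rewrite subr_eq0 => /eqP.
split.
  have [[[u xi] eta] [Vu Mxi Meta] /stepE h] := step_eqs_exists TO (rhof *: g) kk20 muf0 dt0 bN
    monoN lipN bK K0 Weta linF linG B0 cpos coer.
  by exists u, xi, eta.
move=> u u' xi xi' eta eta' Vu Mxi Meta /stepE h Vu' Mxi' Meta' /stepE h'.
have := step_eqs_unique TO muf0 dt0 bN monoN bK K0 Weta B0 cpos coer
  (And3 Vu Mxi Meta : fe_space Omega Th ((u, xi), eta))
  (And3 Vu' Mxi' Meta' : fe_space Omega Th ((u', xi'), eta')) h h'.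
by case.
Qed.
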